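(* Let $T$ be a triangulation of a closed connected topological surface $M$, with vertex set $V$ and set of triangles $F$. For $I\subset V$ let $F_I\subset F$ be the set of all triangles having at least one vertex in $I$. Then there exists a PL metric associated to $T$ with constant PL scalar curvature if and only if for every non-empty proper subset $I$ of $V$, $$\frac{|F_I|}{|I|}>\frac{|F|}{|V|}.\qquad ( * )$$ Furthermore, condition $( * )$ (for all non-empty proper subsets $I\subset V$) holds for every triangulation of every closed connected surface of non-negative Euler characteristic.
   Context: $|X|$ denotes the number of elements of a finite set $X$. Let $E$ be the set of edges of $T$. A PL metric associated to $T$ is a function $d:E\to\mathbb{R}_{>0}$ such that for every triangle of $T$ the three values of $d$ on its edges satisfy the strict triangle inequalities; each triangle of $T$ is then identified with the Euclidean triangle having these edge lengths. The PL scalar curvature of $d$ at a vertex $v$ is $K(v)=2\pi-\alpha(v)$, where $\alpha(v)$ is the sum of the inner angles at $v$ of all triangles of $T$ having $v$ as a vertex. Constant PL scalar curvature means that $K(v)$ is the same for all $v\in V$ (by Gauss–Bonnet, it is then $2\pi\chi(M)/|V|$). *)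

(* Defs.v *)
From HB Require Import structures.
From mathcomp Require Import all_boot all_order all_algebra.
From mathcomp Require Import all_classical all_reals all_analysis.

Set Implicit Arguments.
Unset Strict Implicit.
Unset Printing Implicit Defensive.

Import Order.TTheory GRing.Theory Num.Theory.
Import numFieldNormedType.Exports.

Local Open Scope classical_set_scope.
Local Open Scope ring_scope.

Definition homeomorphic (X Y : topologicalType) : Prop :=
  exists (f : X -> Y) (g : Y -> X),
    [/\ cancel f g, cancel g f, continuous f & continuous g].

Definition locally_euclidean2 (R : realType) (M : topologicalType) : Prop :=
  forall p : M, exists (U : set M) (W : set 'rV[R]_2),
    [/\ open U, U p, open W &
        homeomorphic (set_type U : topologicalType)
                     (set_type W : topologicalType)].

(* "Closed" means compact without boundary: every point, without exception,
   has a neighbourhood homeomorphic to an open subset of the plane. *)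
Definition closed_connected_surface (R : realType) (M : topologicalType) :
    Prop :=
  [/\ hausdorff_space M, @second_countable M, locally_euclidean2 R M,
      compact [set: M] & [set: M] !=set0 /\ connected [set: M]].

Section Triangulation.
Variables (R : realType) (V : finType) (F : {set {set V}}).

(* A triangulation with vertex set V is given by the set F of its triangles,
   each of them being the set of its three vertices. *)
Definition edges : {set {set V}} :=
  [set e : {set V} | (#|e| == 2)%N && [exists f in F, e \subset f]].

(* The geometric realization: points are given by barycentric coordinates
   supported in some triangle. *)
Definition realization : set (prod_topology (fun _ : V => R)) :=
  [set x | [/\ forall v, 0 <= x v, \sum_v x v = 1 &
     exists2 f : {set V}, f \in F & forall v, v \notin f -> x v = 0]].

Definition triangulation (M : topologicalType) : Prop :=
  [/\ forall f : {set V}, f \in F -> #|f| = 3%N,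
      forall v : V, exists2 f : {set V}, f \in F & v \in f &
      homeomorphic (set_type realization : topologicalType) M].

Definition euler_characteristic : int :=
  #|V|%:Z - #|edges|%:Z + #|F|%:Z.

Definition triangles_meeting (I : {set V}) : {set {set V}} :=
  [set f in F | [exists v in I, v \in f]].

(* Only the values of d on [edges] matter.  The edges of a triangle f are the
   sets f :\ v for v in f, and f :\ v is the edge opposite to v. *)
Definition pl_metric (d : {set V} -> R) : Prop :=
  (forall e : {set V}, e \in edges -> 0 < d e) /\
  (forall f : {set V}, f \in F -> forall v, v \in f ->
     d (f :\ v) < \sum_(w in f :\ v) d (f :\ w)).

(* Law of cosines: if f = {v, w, w'}, with sides a opposite to v and b, c
   adjacent to v, this is acos ((b^2 + c^2 - a^2) / (2bc)). *)
Definition inner_angle (d : {set V} -> R) (f : {set V}) (v : V) : R :=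
  acos ((\sum_(w in f :\ v) d (f :\ w) ^+ 2 - d (f :\ v) ^+ 2)
        / (2 * \prod_(w in f :\ v) d (f :\ w))).

Definition scalar_curvature (d : {set V} -> R) (v : V) : R :=
  2 * pi - \sum_(f in F | v \in f) inner_angle d f v.

Definition constant_curvature (d : {set V} -> R) : Prop :=
  forall v w : V, scalar_curvature d v = scalar_curvature d w.

Definition star_condition : Prop :=
  forall I : {set V}, I != finset.set0 -> I \proper [set: V]%SET ->
    #|triangles_meeting I|%:R / #|I|%:R > #|F|%:R / #|V|%:R :> R.

End Triangulation.

Arguments euler_characteristic {V} F.

(* Main.v *)
Require Import Defs.
From mathcomp Require Import all_boot all_order all_algebra.
From mathcomp Require Import all_classical all_reals all_analysis.
From mathcomp Require Import ring lra zify.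

(** The angles of a triangle add up to [pi], so the cone angles (the sums of
    the angles around the vertices) of a PL metric have total [pi * #|F|].  A
    triangle meeting [I] contributes at most [pi] to the cone angles at [I],
    and strictly less when one of its vertices is outside [I], which happens
    for some triangle since the surface is connected ([angle_sum_lt]).  When
    all cone angles are equal, this is the inequality of the star condition.

    Conversely, the PL metric is found among those given by tangent circles,
    where an edge has the sum of the radii at its ends as length.  By a theorem
    of Thurston, the only constraints on the cone angles [theta] of such a
    packing are that they add up to [pi * #|F|], and to less than
    [pi * #|triangles_meeting F I|] over each proper part [I]
    ([prescribed_cone_angles]); the star condition says that the constant
    function satisfies them.  The proof uses that the angle at a vertex decreases
    with its radius and increases with the radii of its neighbours.  Thus, as
    long as the maximum of [cone angle - theta] is positive, it can be lowered
    by repeatedly enlarging the circles where it is attained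
    ([decrease_excess]).  If some radii degenerate, the cone angles at the small
    circles add up to nearly [pi * #|triangles_meeting F I|], which forbids a
    small maximum ([excess_proper]).  Hence the maximum has a minimum, equal to
    [0], once it is known to take a small value; this is ensured by moving
    [theta] in small steps from the cone angles of the unit radii.

    For the last statement, let [I] be a proper part that is connected along
    edges.  If every triangle meets [I], the star inequality is trivial.
    Otherwise the boundary of the union of the triangles that miss [I] is a
    cycle modulo 2, hence has at least three edges, each of which is opposite
    to the only vertex in [I] of a triangle ([three_triangles_meeting_once]).
    Moreover, the complex spanned by [I] can be collapsed to a connected graph,
    so its Euler characteristic is at most [1] ([collapse_count]).  Counting
    edges by triangles gives [2 * #|I| < #|triangles_meeting F I|], whereas
    [#|F| <= 2 * #|V|] if the Euler characteristic of the surface is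
    non-negative.

    These counts rest on three properties of the triangulation of a surface:
    every edge is in exactly two triangles, the triangles around a vertex are
    connected through their edges at the vertex, and no non-empty proper set of
    vertices is a union of components.  The last one is the connectedness of the surface,
    and the second one holds because a punctured disc is connected.  The first
    one follows from invariance of domain in the plane
    ([invariance_of_domain]), which is derived from the theorem of Poincare and
    Miranda on zeros of maps of the square, itself a consequence of Sperner's
    lemma. *)

Import Order.TTheory GRing.Theory Num.Theory.
Import numFieldNormedType.Exports.
Local Open Scope ring_scope.

(** * Combinatorics of triangulated closed surfaces *)

Section ClosedSurfaceCombinatorics.
Local Open Scope nat_scope.
Context (V : finType) (F : {set {set V}}).

Lemma edgesP (e : {set V}) :
  reflect (#|e| = 2 /\ exists2 f, f \in F & e \subset f) (e \in edges F).
Proof.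
rewrite inE; apply: (iffP andP) => [[/eqP-> /exists_inP[f fF ef]]|[-> [f fF ef]]].
  by split=> //; exists f.
by split=> //; apply/exists_inP; exists f.
Qed.

Lemma edge_set2 (f : {set V}) (x y : V) :
  f \in F -> x \in f -> y \in f -> x != y -> [set x; y] \in edges F.
Proof.
move=> fF xf yf xy; apply/edgesP; split; first by rewrite cards2 xy.
by exists f => //; rewrite finset.subUset !finset.sub1set xf.
Qed.

(** Grow a subset of [I] one vertex at a time; each new vertex is reached
    through a new edge. *)
Lemma connected_graph_card (I : {set V}) (G : {set {set V}}) :
  (forall A : {set V}, A \proper I -> A != finset.set0 ->
     exists x y, [/\ x \in A, y \in I :\: A & [set x; y] \in G]) ->
  #|I| <= #|G|.+1.
Proof.
move=> con.
have [->|[x0 x0I]] := set_0Vmem I; first by rewrite cards0.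
have grow k : k < #|I| -> exists A : {set V},
    [/\ A \subset I, #|A| = k.+1 & k <= #|[set e in G | e \subset A]|].
  elim: k => [_|k IHk kI].
    by exists [set x0]; rewrite finset.sub1set cards1.
  have [A [AI cA GA]] := IHk (ltnW kI).
  have A0 : A != finset.set0 by rewrite -card_gt0 cA.
  have pA : A \proper I.
    by rewrite finset.properEcard AI cA.
  have [x [y [xA]]] := con A pA A0.
  rewrite inE => /andP[yA yI] xyG.
  exists (y |: A); split.
  - by rewrite finset.subUset finset.sub1set yI.
  - by rewrite cardsU1 yA cA.
  apply: leq_ltn_trans GA _; apply: proper_card.
  apply/fintype.properP; split.
    apply/fintype.subsetP => e; rewrite !inE => /andP[-> /= eA].
    exact: fintype.subset_trans eA (finset.subsetUr _ _).
  exists [set x; y]; rewrite !inE xyG /=.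
    by rewrite finset.subUset !finset.sub1set !inE xA eqxx orbT.
  by rewrite finset.subUset !finset.sub1set (negbTE yA) andbF.
have I0 : 0 < #|I| by rewrite card_gt0; apply/set0Pn; exists x0.
have [|A [_ _ cG]] := grow #|I|.-1; first by rewrite prednK.
rewrite -(prednK I0) ltnS; apply: leq_trans cG _.
by apply: subset_leq_card; apply/fintype.subsetP => e; rewrite inE => /andP[].
Qed.

Hypothesis triangle3 : forall f, f \in F -> #|f| = 3.
Hypothesis covered : forall v : V, exists2 f, f \in F & v \in f.
Hypothesis edge_two_triangles : forall e, e \in edges F ->
  #|[set f in F | e \subset f]| = 2.
Hypothesis link_connected : forall (v : V) (A : {set {set V}}),
  A \subset F -> (exists2 f, f \in A & v \in f) ->
  (exists2 g, g \in F :\: A & v \in g) ->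
  exists e f g, [/\ e \in edges F, f \in A, g \in F :\: A, e \subset f &
                   e \subset g].
Hypothesis vertices_connected : forall I : {set V},
  I != finset.set0 -> I \proper [set: V]%SET ->
  exists f x y, [/\ f \in F, x \in f, y \in f, x \in I & y \notin I].

(** If no vertex is common to a triangle of [A] and one outside [A], the
    vertices of [A] are separated from the others; otherwise the link of a
    common vertex provides the edge. *)
Lemma strongly_connected (A : {set {set V}}) :
  A \proper F -> A != finset.set0 ->
  exists e f g, [/\ e \in edges F, f \in A, g \in F :\: A, e \subset f &
                   e \subset g].
Proof.
move=> /fintype.properP[AF [g0 g0F g0A]] /set0Pn[f0 f0A].
pose VA := \bigcup_(f in A) f.
case: (boolP [exists g in F :\: A, [exists v in g, v \in VA]]).
  move=> /exists_inP[g gA /exists_inP[v vg /bigcupP[f fA vf]]].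
  by apply: (link_connected v) => //; [exists f|exists g].
move=> /exists_inPn sep.
have disj g v : g \in F -> g \notin A -> v \in g -> v \notin VA.
  move=> gF gA vg; have /exists_inPn/(_ _ vg) // : ~~ [exists v in g, v \in VA].
  by apply: sep; rewrite inE gA.
have /set0Pn[x0 x0f0] : f0 != finset.set0.
  by rewrite -card_gt0 triangle3 // (fintype.subsetP AF).
have /set0Pn[y0 y0g0] : g0 != finset.set0 by rewrite -card_gt0 triangle3.
have [||f [x [y [fF xf yf xVA /negP[]]]]] := vertices_connected VA.
- by apply/set0Pn; exists x0; apply/bigcupP; exists f0.
- apply/fintype.properP; split; first exact: finset.subsetT.
  by exists y0; [exact: finset.in_setT|exact: disj y0g0].
apply/bigcupP; exists f => //; apply: contraT => fA.
by have := disj f x fF fA xf; rewrite xVA.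
Qed.

(** Collapse a triangle of [H] through an edge that it shares with a triangle
    outside [H]: this removes one triangle and one edge, and keeps the graph
    connected since the two other sides of the triangle remain. *)
Lemma collapse_count (I : {set V}) (G H : {set {set V}}) :
  H \proper F ->
  (forall f e, f \in H -> e \in edges F -> e \subset f -> e \in G) ->
  (forall A : {set V}, A \proper I -> A != finset.set0 ->
     exists x y, [/\ x \in A, y \in I :\: A & [set x; y] \in G]) ->
  (forall f, f \in H -> f \subset I) ->
  #|H| + #|I| <= #|G|.+1.
Proof.
move: {2}#|H| (erefl #|H|) => k.
elim: k G H => [|k IHk] G H cH pH HG con HI.
  by rewrite cH; apply: connected_graph_card.
have H0 : H != finset.set0 by rewrite -card_gt0 cH.
have [e [f [g [eE fH gH ef eg]]]] := strongly_connected H pH H0.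
move: gH; rewrite inE => /andP[gH gF].
have HF := proper_sub pH.
have fF := fintype.subsetP HF _ fH.
have eG := HG _ _ fH eE ef.
have fg : f != g by apply: contraNneq gH => <-.
have two : [set h in F | e \subset h] = [set f; g].
  apply/esym/eqP; rewrite eqEcard edge_two_triangles // cards2 fg leqnn andbT.
  by apply/fintype.subsetP => h; rewrite !inE => /orP[]/eqP->; apply/andP.
have cHf : #|H :\ f| = k by move: cH; rewrite (cardsD1 f H) fH => -[].
rewrite (cardsD1 f H) fH (cardsD1 e G) eG !add1n addSn ltnS.
apply: (IHk (G :\ e) (H :\ f)) => //.
- exact: sub_proper_trans (finset.subsetDl _ _) pH.
- move=> h e'; rewrite finset.in_setD1 => /andP[hf hH] e'E e'h.
  rewrite finset.in_setD1 (HG _ _ hH e'E e'h) andbT; apply: contraNneq hf => e'e.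
  have : h \in [set h in F | e \subset h].
    by rewrite inE (fintype.subsetP HF) //= -e'e.
  rewrite two !inE => /orP[//|/eqP hg].
  by rewrite hg (negbTE gH) in hH.
- move=> A pA A0; have [x [y [xA yA xyG]]] := con A pA A0.
  have [xye|ne] := eqVneq [set x; y] e; last first.
    by exists x, y; rewrite finset.in_setD1 ne.
  have yNA : y \notin A by move: yA; rewrite inE => /andP[].
  have xNy : x != y by apply: contraNneq yNA => <-.
  have xf : x \in f by rewrite (fintype.subsetP ef) // -xye !inE eqxx.
  have yf : y \in f by rewrite (fintype.subsetP ef) // -xye !inE eqxx orbT.
  have /set0Pn[z] : f :\: e != finset.set0.
    rewrite -card_gt0 cardsD (finset.setIidPr ef) triangle3 //.
    by rewrite -xye cards2 xNy.
  rewrite -xye !inE negb_or -andbA => /and3P[zx zy zf].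
  have zI := fintype.subsetP (HI f fH) _ zf.
  have xzG : [set x; z] \in G :\ e.
    rewrite !inE (HG f) ?andbT //; last 2 first.
    - by apply: edge_set2 fF _ _ _; rewrite // eq_sym.
    - by rewrite finset.subUset !finset.sub1set xf.
    apply: contraNneq yNA => /setP/(_ z); rewrite -xye !inE eqxx orbT.
    by rewrite (negbTE zx) (negbTE zy).
  have zyG : [set z; y] \in G :\ e.
    rewrite !inE (HG f) ?andbT //; last 2 first.
    - exact: edge_set2 fF _ _ _.
    - by rewrite finset.subUset !finset.sub1set yf zf.
    apply: contraNneq yNA => /setP/(_ z); rewrite -xye !inE eqxx.
    by rewrite (negbTE zx) (negbTE zy).
  rewrite xye.
  have [zA|zA] := boolP (z \in A); first by exists z, y.
  by exists x, z; split=> //; rewrite finset.in_setD zA.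
- by move=> h; rewrite inE => /andP[_ /HI].
Qed.

Lemma sum_mem_card (T : finType) (A : {set T}) (P : pred T) :
  \sum_(x in A) P x = #|[set x in A | P x]|.
Proof.
rewrite -sum1_card big_mkcond [RHS]big_mkcond /=; apply: eq_bigr => x _.
by rewrite inE; case: (x \in A); case: (P x).
Qed.

(** Count the pairs of a triangle and one of its sides spanned by [I]; the factor
    [2] is the number of triangles at an edge. *)
Lemma double_count_edges (I : {set V}) :
  #|[set e in edges F | e \subset I]| * 2 = \sum_(f in F) 'C(#|f :&: I|, 2).
Proof.
rewrite -sum_nat_const.
transitivity (\sum_(e in [set e in edges F | e \subset I])
                \sum_(f in F) (e \subset f)).
  apply: eq_bigr => e; rewrite inE => /andP[eE _].
  by rewrite sum_mem_card edge_two_triangles.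
rewrite exchange_big /=; apply: eq_bigr => f fF.
rewrite sum_mem_card -cards_draws; apply: eq_card => e.
rewrite !inE finset.subsetI; apply/idP/idP.
  by move=> /andP[/andP[/andP[-> _] ->] ->].
move=> /andP[/andP[ef eI] ->]; rewrite eI ef !andbT /=.
by apply/exists_inP; exists f.
Qed.

Definition meeting_in (k : nat) (I : {set V}) : {set {set V}} :=
  [set f in F | #|f :&: I| == k].

Lemma meetingE I f :
  (f \in triangles_meeting F I) = (f \in F) && (0 < #|f :&: I|).
Proof.
rewrite inE card_gt0; congr andb; apply/exists_inP/set0Pn => -[v].
  by move=> vI vf; exists v; rewrite inE vI vf.
by rewrite inE => /andP[vf vI]; exists v.
Qed.

(** A triangle with [k] vertices in [I] has [0], [0], [1], [3] sides spanned by
    [I] for [k = 0, 1, 2, 3]. *)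
Lemma count_by_intersection (I : {set V}) :
  #|[set e in edges F | e \subset I]| * 2 + #|meeting_in 1 I| =
  #|triangles_meeting F I| + #|meeting_in 3 I| * 2.
Proof.
have -> : triangles_meeting F I = [set f in F | 0 < #|f :&: I|].
  by apply/setP => f; rewrite meetingE inE.
rewrite double_count_edges -!sum_mem_card big_distrl /= -!big_split /=.
apply: eq_bigr => f fF.
have : #|f :&: I| <= 3 by rewrite -(triangle3 f fF) subset_leq_card ?finset.subsetIl.
by case: #|f :&: I| => [|[|[|[|]]]].
Qed.

(** The edges separating a set of triangles [A] from the others form a cycle
    modulo 2: the triangles of [A] around [x] have an even total number of
    sides at [x], and the edges interior to [A] are counted twice. *)
Lemma boundary_cycle (A : {set {set V}}) (e : {set V}) (x : V) :
  A \subset F -> e \in edges F -> x \in e ->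
  #|[set f in A | e \subset f]| = 1 ->
  exists e', [/\ e' \in edges F, x \in e', e' != e &
                 #|[set f in A | e' \subset f]| = 1].
Proof.
move=> AF eE xe ce.
case: (boolP [exists e' in edges F, [&& x \in e', e' != e &
  #|[set f in A | e' \subset f]| == 1]]) => [/exists_inP|/exists_inPn no].
  by move=> [e' e'E /and3P[? ? /eqP ?]]; exists e'.
exfalso.
have : \sum_(e' in edges F | x \in e') #|[set f in A | e' \subset f]|
     = \sum_(f in A | x \in f) 2.
  under eq_bigr => e' _ do rewrite -sum_mem_card.
  rewrite (exchange_big_dep (mem A)) //= [RHS]big_mkcondr /=.
  apply: eq_bigr => f fA; have fF := fintype.subsetP AF _ fA.
  rewrite -big_mkcondr /=.
  transitivity #|[set e' in edges F | (x \in e') && (e' \subset f)]|.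
    rewrite -sum1_card big_mkcond [RHS]big_mkcond; apply: eq_bigr => e' _.
    rewrite finset.in_set; case: (e' \in edges F) => //=.
    by rewrite fA andbT.
  case: ifP => xf; last first.
    apply: eq_card0 => e'; rewrite finset.in_set; apply/negP.
    move=> /and3P[_ xe' /fintype.subsetP/(_ x xe')].
    by rewrite xf.
  have <- : #|[set [set x; y] | y in f :\ x]| = 2.
    rewrite card_in_imset; first by have := cardsD1 x f; rewrite xf triangle3 //; case.
    move=> y z; rewrite !inE => /andP[yx _] /andP[zx _] /setP/(_ y).
    by rewrite !inE eqxx orbT (negbTE yx) => /esym/eqP.
  apply: eq_card => e'; rewrite finset.in_set; apply/idP/imsetP.
    move=> /and3P[/edgesP[c2 _] xe' e'f].
    have := cardsD1 x e'; rewrite xe' c2 => -[] /esym/eqP/cards1P[y e'x].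
    have ye' : y \in e' :\ x by rewrite e'x !inE.
    exists y; last by rewrite -(finset.setD1K xe') e'x.
    by move: ye'; rewrite !inE => /andP[-> ye] /=; exact: fintype.subsetP e'f _ ye.
  move=> [y /finset.setD1P[yx yf] ->].
  by rewrite (edge_set2 f) // 1?eq_sym // finset.subUset !finset.sub1set xf yf !inE
      eqxx.
rewrite (bigD1 e) /=; last by rewrite eE.
rewrite ce sum_nat_const => /(congr1 odd); rewrite oddM andbF oddD /=.
rewrite -[odd _]negbK -dvdn2 dvdn_sum // => i /andP[/andP[iE xi] ie].
have := no i iE; rewrite xi ie /=.
have : #|[set f in A | i \subset f]| <= 2.
  rewrite -(edge_two_triangles i iE); apply: subset_leq_card.
  apply/fintype.subsetP => f; rewrite !inE => /andP[/(fintype.subsetP AF) -> ->].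
  by [].
by case: #|_| => [|[|[|]]].
Qed.

(** The triangles missing [I] have a boundary of at least three edges, each of
    them opposite to the only vertex in [I] of a triangle. *)
Lemma three_triangles_meeting_once (I : {set V}) :
  I != finset.set0 -> triangles_meeting F I != F -> 3 <= #|meeting_in 1 I|.
Proof.
move=> I0 FI.
have [A AE] : exists A : {set {set V}},
    forall f, (f \in A) = (f \in F) && (#|f :&: I| == 0).
  by exists (meeting_in 0 I) => f; rewrite finset.in_set.
have AF : A \subset F by apply/fintype.subsetP => f; rewrite AE => /andP[].
have AI f : f \in A -> f :&: I = finset.set0.
  by rewrite AE cards_eq0 => /andP[_ /eqP].
have A0 : A != finset.set0.
  apply: contra FI => /eqP A0; apply/eqP/setP => f; rewrite meetingE lt0n.
  by have := AE f; rewrite A0 finset.in_set0; case: (f \in F) => //= <-.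
have pA : A \proper F.
  apply/fintype.properP; split=> //.
  have /set0Pn[v vI] := I0; have [f fF vf] := covered v.
  exists f => //; apply/negP => /AI/setP/(_ v); by rewrite !inE vf vI.
pose B := [set e in edges F | #|[set f in A | e \subset f]| == 1].
have [e [f [g [eE fA]]]] := strongly_connected A pA A0.
rewrite finset.in_setD => /andP[gA gF] ef eg.
have fF := fintype.subsetP AF _ fA.
have fg : f != g by apply: contraNneq gA => <-.
have two : [set h in F | e \subset h] = [set f; g].
  apply/esym/eqP; rewrite eqEcard edge_two_triangles // cards2 fg leqnn andbT.
  by apply/fintype.subsetP => h; rewrite !inE => /orP[]/eqP->; apply/andP.
have eB : e \in B.
  rewrite finset.in_set eE /=; apply/cards1P; exists f; apply/setP => h.
  rewrite finset.in_set finset.in_set1; apply/andP/eqP => [[hA eh]|->//].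
  have : h \in [set h in F | e \subset h].
    by rewrite finset.in_set (fintype.subsetP AF).
  rewrite two !inE => /orP[/eqP//|/eqP hg].
  by move: gA; rewrite -hg hA.
have cycle (e' : {set V}) x : e' \in B -> x \in e' ->
    exists e'', [/\ e'' \in B, x \in e'' & e'' != e'].
  rewrite finset.in_set => /andP[e'E /eqP ce'] xe'.
  have [e'' [? ? ? ce'']] := boundary_cycle A e' x AF e'E xe' ce'.
  by exists e''; split=> //; rewrite finset.in_set; apply/andP; split=> //; apply/eqP.
have [c2 _] := edgesP e eE.
have /cards2P[x [y [xy exy]]] : #|e| == 2 by rewrite c2.
have [e1 [e1B xe1 e1e]] : exists e', [/\ e' \in B, x \in e' & e' != e].
  by apply: cycle; rewrite // exy !inE eqxx.
have [e2 [e2B ye2 e2e]] : exists e', [/\ e' \in B, y \in e' & e' != e].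
  by apply: cycle; rewrite // exy !inE eqxx orbT.
have e12 : e1 != e2.
  apply: contraNneq e1e => e12; rewrite eq_sym eqEcard c2.
  move: e1B; rewrite finset.in_set => /andP[/edgesP[-> _] _].
  by rewrite leqnn andbT exy finset.subUset !finset.sub1set xe1 e12.
have B3 : 3 <= #|B|.
  have -> : 3 = #|e |: [set e1; e2]|.
    by rewrite cardsU1 cards2 e12 !inE negb_or ![e == _]eq_sym e1e e2e.
  by apply: subset_leq_card; rewrite !finset.subUset !finset.sub1set eB e1B.
apply: leq_trans B3 _.
apply: leq_trans (leq_imset_card (fun h => h :\: I) _).
apply: subset_leq_card; apply/fintype.subsetP => e'.
rewrite finset.in_set => /andP[e'E /eqP ce'].
have /set0Pn[h] : [set h in F | e' \subset h] :\: [set h in A | e' \subset h] !=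
    finset.set0.
  apply/negP; rewrite finset.setD_eq0 => /subset_leq_card.
  by rewrite ce' edge_two_triangles.
rewrite finset.in_setD !finset.in_set => /andP[hA /andP[hF e'h]].
have /eqP/cards1P[h' Eh'] := ce'.
have : h' \in [set h in A | e' \subset h] by rewrite Eh' finset.in_set1.
rewrite finset.in_set => /andP[/AI h'I e'h'].
have e'I : e' :&: I = finset.set0.
  by apply/eqP; rewrite -finset.subset0 -h'I finset.setSI.
have {}hA : 0 < #|h :&: I| by move: hA; rewrite e'h andbT AE hF /= lt0n.
have [ce'2 _] := edgesP e' e'E.
have e'hI : e' \subset h :\: I.
  apply/fintype.subsetP => v ve'; rewrite finset.in_setD (fintype.subsetP e'h _ ve')
      andbT.
  by apply/negP => vI; have /setP/(_ v) := e'I; rewrite !inE ve' vI.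
have c3 := cardsID I h; rewrite (triangle3 h hF) in c3.
have le2 := subset_leq_card e'hI; rewrite ce'2 in le2.
have [h1 h2] : #|h :&: I| = 1 /\ #|h :\: I| = 2.
  by move: #|_ :&: _| #|_ :\: _| c3 le2 hA => a b; clear; lia.
apply/imsetP; exists h; first by rewrite finset.in_set hF h1.
by apply/eqP; rewrite eqEcard e'hI ce'2 h2.
Qed.

Lemma triangles_gt0 (I : {set V}) :
  I != finset.set0 -> 0 < #|F|.
Proof.
by move=> /set0Pn[v _]; rewrite card_gt0; have [f fF _] := covered v; apply/set0Pn;
    exists f.
Qed.

(** Passing to a connected component of the graph spanned by [I] is harmless
    since a triangle meets at most one of them.  For connected [I], the
    triangles inside [I] can be collapsed, and counting edges by triangles
    gives at least [2 |I| + 1] triangles meeting [I]. *)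
Lemma star_inequality (I : {set V}) :
  #|edges F| <= #|V| + #|F| -> I != finset.set0 -> I \proper [set: V]%SET ->
  #|F| * #|I| < #|triangles_meeting F I| * #|V|.
Proof.
move=> chi; have [n leIn] := ubnP #|I|; elim: n I leIn => // n IHn I /ltnSE leIn I0 pI.
have F0 := triangles_gt0 I I0.
have IV : #|I| < #|V| by have := proper_card pI; rewrite cardsT.
have [->|FI] := eqVneq (triangles_meeting F I) F; first by rewrite ltn_pmul2l.
have F1 := three_triangles_meeting_once I I0 FI.
case: (boolP [exists A : {set V}, [&& A \proper I, A != finset.set0 &
   [forall x in A, forall y in I :\: A, [set x; y] \notin edges F]]]).
  move=> /existsP[A /and3P[pA A0 /forall_inP sep]].
  have AI := proper_sub pA.
  have D0 : I :\: A != finset.set0.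
    by rewrite finset.setD_eq0; move: pA; rewrite /proper => /andP[].
  have cI : #|I| = #|A| + #|I :\: A|.
    by rewrite -(cardsID A I) (finset.setIidPr AI).
  have cA0 : 0 < #|A| by rewrite card_gt0.
  have cD0 : 0 < #|I :\: A| by rewrite card_gt0.
  have [lt1 lt2] : #|I :\: A| < n /\ #|A| < n.
    by move: #|_ :\: _| #|A| #|I| cI cA0 cD0 leIn => a b c; clear; lia.
  have := IHn A; have := IHn (I :\: A).
  move=> /(_ lt1 D0) + /(_ lt2 A0).
  move=> /(_ (sub_proper_trans (finset.subsetDl _ _) pI)).
  move=> + /(_ (proper_trans pA pI)).
  have -> : triangles_meeting F I =
      triangles_meeting F A :|: triangles_meeting F (I :\: A).
    apply/setP => f; rewrite finset.in_setU !meetingE !card_gt0.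
    case: (f \in F) => //=.
    rewrite -negb_and -finset.setU_eq0 -finset.setIUr.
    by rewrite -{1}(finset.setIidPr AI) finset.setID.
  rewrite cardsU.
  have -> : triangles_meeting F A :&: triangles_meeting F (I :\: A) = finset.set0.
    apply/setP => f; rewrite finset.in_setI !meetingE !card_gt0 finset.in_set0.
    apply/negP => /andP[/andP[fF /set0Pn[x xfA]] /andP[_ /set0Pn[y yfA]]].
    move: xfA yfA; rewrite !(finset.in_setI _ f) => /andP[xf xA] /andP[yf yIA].
    have /forall_inP/(_ y yIA)/negP := sep x xA; apply.
    apply: edge_set2 fF xf yf _; apply/negP => /eqP xy.
    by move: yIA; rewrite -xy inE xA.
  rewrite cards0 subn0 cI mulnDr mulnDl => ltD ltA.
  by rewrite -addSn leq_add // ltnW.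
move=> /existsPn con.
have con' (A : {set V}) : A \proper I -> A != finset.set0 ->
    exists x y, [/\ x \in A, y \in I :\: A & [set x;
        y] \in [set e in edges F | e \subset I]].
  move=> pA A0; have := con A; rewrite pA A0 /=.
  move=> /forall_inPn[x xA /forall_inPn[y yA]]; rewrite negbK => xyE.
  exists x, y; split=> //; rewrite finset.in_set xyE finset.subUset !finset.sub1set.
  rewrite (fintype.subsetP (proper_sub pA)) //=.
  by move: yA; rewrite inE => /andP[].
have HI f : f \in meeting_in 3 I -> f \in F /\ f \subset I.
  rewrite finset.in_set => /andP[fF /eqP c3]; split=> //.
  by apply/finset.setIidPl/eqP; rewrite eqEcard finset.subsetIl c3 triangle3.
have sub3 : meeting_in 3 I \proper F.
  apply/fintype.properP; split; first by apply/fintype.subsetP => f /HI[].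
  have /set0Pn[f] : meeting_in 1 I != finset.set0 by rewrite -card_gt0;
      exact: leq_trans F1.
  rewrite finset.in_set => /andP[fF /eqP c1]; exists f => //.
  by rewrite finset.in_set fF c1.
have HG f e : f \in meeting_in 3 I -> e \in edges F -> e \subset f ->
    e \in [set e in edges F | e \subset I].
  move=> /HI[fF fI] eE ef; rewrite finset.in_set eE /=.
  exact: fintype.subset_trans ef fI.
have col := collapse_count I _ (meeting_in 3 I) sub3 HG con' (fun f h => (HI f h).2).
have cnt := count_by_intersection I.
have E3 : #|edges F| * 2 = #|F| * 3.
  have <- : #|[set e in edges F | e \subset [set: V]%SET]| = #|edges F|.
    by apply: eq_card => e; rewrite finset.in_set finset.subsetT andbT.
  rewrite double_count_edges -sum_nat_const; apply: eq_bigr => f fF.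
  by rewrite finset.setIT triangle3.
have ltI : #|I| * 2 < #|triangles_meeting F I|.
  move: #|meeting_in 3 I| #|I| #|[set e in _ | _]| #|triangles_meeting F I|
    #|meeting_in 1 I| col cnt F1 => a b c d e; clear; lia.
have leF : #|F| <= #|V| * 2 by move: #|edges F| #|F| #|V| chi E3 => a b c; clear; lia.
apply: (@leq_ltn_trans (#|V| * 2 * #|I|)); first by rewrite leq_mul2r leF orbT.
by rewrite -mulnA [2 * _]mulnC mulnC ltn_pmul2r // (leq_ltn_trans _ IV).
Qed.

End ClosedSurfaceCombinatorics.

(** * Angles of Euclidean triangles *)

Section EuclideanTriangle.
Context (R : realType).

(** The cosine of the angle opposite to the side of length [a]. *)
Definition cosine_law (a b c : R) : R := (b ^+ 2 + c ^+ 2 - a ^+ 2) / (2 * (b * c)).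

Lemma cosine_law_itv (a b c : R) : 0 < a -> 0 < b -> 0 < c ->
  a < b + c -> b < a + c -> c < a + b -> -1 < cosine_law a b c < 1.
Proof.
move=> a0 b0 c0 ha hb hc; have bc0 : 0 < b * c by rewrite mulr_gt0.
by rewrite /cosine_law ltr_pdivlMr ?ltr_pdivrMr ?mulr_gt0 //; apply/andP; split; nra.
Qed.

(** Heron's formula: the square root is four times the area, which is symmetric
    in the sides, so that the products in the addition formulas simplify. *)
Lemma sin_acos_cosine_law (a b c : R) : 0 < a -> 0 < b -> 0 < c ->
  a < b + c -> b < a + c -> c < a + b ->
  sin (acos (cosine_law a b c)) =
  Num.sqrt ((a + b + c) * (b + c - a) * (a + c - b) * (a + b - c)) / (2 * (b * c)).
Proof.
move=> a0 b0 c0 ha hb hc; have bc0 : 0 < 2 * (b * c) by rewrite !mulr_gt0.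
have /andP[h1 h2] := cosine_law_itv _ _ _ a0 b0 c0 ha hb hc.
rewrite sin_acos; last by rewrite !ltW.
rewrite -[X in _ / X](@ger0_norm _ (2 * (b * c))) ?ltW // -sqrtr_sqr -sqrtrV ?sqr_ge0
    //.
rewrite -sqrtrM; last by rewrite !mulr_ge0 //; lra.
congr Num.sqrt; rewrite /cosine_law; field; rewrite ?gt_eqF //.
Qed.

(** The addition formulas give [cos (A + B) = - cos C] and [sin (A + B) > 0],
    the latter to exclude [A + B = pi + C]. *)
Lemma triangle_angle_sum (a b c : R) : 0 < a -> 0 < b -> 0 < c ->
  a < b + c -> b < a + c -> c < a + b ->
  acos (cosine_law a b c) + acos (cosine_law b a c) + acos (cosine_law c a b) = pi.
Proof.
move=> a0 b0 c0 ha hb hc.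
have iA := cosine_law_itv _ _ _ a0 b0 c0 ha hb hc.
have iB := cosine_law_itv _ _ _ b0 a0 c0 hb ha ltac:(lra).
have iC := cosine_law_itv _ _ _ c0 a0 b0 hc ltac:(lra) ltac:(lra).
have sA := sin_acos_cosine_law _ _ _ a0 b0 c0 ha hb hc.
have sB := sin_acos_cosine_law _ _ _ b0 a0 c0 hb ha ltac:(lra).
have weak (x : R) : -1 < x < 1 -> -1 <= x <= 1 by move=> /andP[? ?]; rewrite !ltW.
have cA : cos (acos (cosine_law a b c)) = cosine_law a b c.
  by rewrite acosK // in_itv /=; apply: weak.
have cB : cos (acos (cosine_law b a c)) = cosine_law b a c.
  by rewrite acosK // in_itv /=; apply: weak.
have sC := acosN (weak _ iC).
have acos_itv (x : R) : -1 < x < 1 -> 0 < acos x < pi.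
  move=> xi; have := weak x xi; move: xi => /andP[x1 x2] /andP[x3 x4].
  by rewrite acos_gt0 ?acos_ltpi // ?x1 ?x2 ?x3 ?x4.
have /andP[A0 Api] := acos_itv _ iA.
have /andP[B0 Bpi] := acos_itv _ iB.
move: A0 Api B0 Bpi sA sB cA cB.
set A := acos (cosine_law a b c); set B := acos (cosine_law b a c).
set S := (a + b + c) * (b + c - a) * (a + c - b) * (a + b - c).
have -> : (b + a + c) * (a + c - b) * (b + c - a) * (b + a - c) = S by rewrite /S; ring.
move=> A0 Api B0 Bpi sA sB cA cB.
have S0 : 0 < S by rewrite /S !mulr_gt0 //; lra.
have cAB : cos (A + B) = - cosine_law c a b.
  have sS x y : Num.sqrt S / x * (Num.sqrt S / y) = S / (x * y).
    by rewrite mulrACA -invfM -expr2 sqr_sqrtr // ltW.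
  rewrite cosD sA sB cA cB sS.
  by rewrite /cosine_law /S; field; rewrite !gt_eqF.
have sAB : 0 < sin (A + B).
  have -> : sin (A + B) = Num.sqrt S / (2 * (a * b)).
    by rewrite sinD sA sB cA cB /cosine_law; field; rewrite !gt_eqF.
  by rewrite divr_gt0 ?sqrtr_gt0 // !mulr_gt0.
have ABpi : A + B < pi.
  rewrite ltNge; apply/negP => le_pi.
  have : 0 <= sin (A + B - pi) by apply: sin_ge0_pi; lra.
  have -> : sin (A + B - pi) = - sin (A + B).
    by rewrite sinB cospi sinpi; ring.
  by rewrite oppr_ge0 leNgt sAB.
have : acos (cos (A + B)) = A + B by rewrite cosK // in_itv /=; lra.
rewrite cAB sC; lra.
Qed.

Lemma acos_lt (x y : R) : -1 <= x -> x < y -> y <= 1 -> acos y < acos x.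
Proof.
move=> x1 xy y1.
have xi : -1 <= x <= 1 by rewrite x1 (le_trans (ltW xy)).
have yi : -1 <= y <= 1 by rewrite y1 (le_trans x1 (ltW xy)).
by rewrite -ltr_cos ?in_itv /= ?acos_ge0 ?acos_lepi // !acosK ?in_itv.
Qed.

Lemma acos_le (x y : R) : -1 <= x -> x <= y -> y <= 1 -> acos y <= acos x.
Proof.
move=> x1; rewrite le_eqVlt => /predU1P[->//|xy] y1.
by rewrite ltW // acos_lt.
Qed.

(** The argument is written [1 - 2 * lam] to match [cosine_law_tangent]. *)
Lemma acos_near1 (eta : R) : 0 < eta ->
  exists2 lam : R, 0 < lam < 1 & forall x, 1 - 2 * lam <= x <= 1 -> acos x <= eta.
Proof.
move=> eta0; pose e := Num.min eta 1.
have e0 : 0 < e by rewrite lt_min eta0 /=.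
have e1 : e <= 1 by rewrite ge_min lexx orbT.
have pi2 := pi_ge2 R.
have ce : cos e < 1.
  by rewrite -[ltRHS]cos0 ltr_cos // in_itv /=; lra.
have cN : -1 <= cos e by exact: cos_geN1.
exists ((1 - cos e) / 3); first lra.
move=> x /andP[x1 x2]; apply: (@le_trans _ _ e); last by rewrite ge_min lexx.
rewrite -[leRHS](@cosK R); first by apply: acos_le => //; lra.
by rewrite in_itv /=; lra.
Qed.

End EuclideanTriangle.

Section TriangleVertices.
Context (V : finType).

Lemma triangle_vertices (f : {set V}) (v : V) : #|f| = 3%N -> v \in f ->
  exists w u, [/\ v != w, v != u, w != u & f = [set v; w; u]].
Proof.
move=> c3 vf; have := cardsD1 v f; rewrite vf c3 => -[] /esym/eqP.
move=> /cards2P[w [u [wu fwu]]].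
have wf : w \in f :\ v by rewrite fwu !inE eqxx.
have uf : u \in f :\ v by rewrite fwu !inE eqxx orbT.
exists w, u; split=> //.
- by move: wf; rewrite !inE eq_sym => /andP[].
- by move: uf; rewrite !inE eq_sym => /andP[].
- by rewrite -(finset.setD1K vf) fwu finset.setUA.
Qed.

Lemma big_triangle (T : Type) (idx : T) (op : Monoid.com_law idx) (v w u : V)
    (G : V -> T) : v != w -> v != u -> w != u ->
  \big[op/idx]_(x in [set v; w; u]) G x = op (G v) (op (G w) (G u)).
Proof.
move=> vw vu wu; rewrite -finset.setUA big_setU1 ?big_setU1 ?big_set1 //=.
- by rewrite !inE.
- by rewrite !inE negb_or vw.
Qed.

Lemma big_other_vertices (T : Type) (idx : T) (op : Monoid.com_law idx)
    (v w u : V) (G : V -> T) : v != w -> v != u -> w != u ->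
  \big[op/idx]_(x in [set v; w; u] :\ v) G x = op (G w) (G u).
Proof.
move=> vw vu wu; have -> : [set v; w; u] :\ v = [set w; u].
  apply/setP => x; rewrite !inE -orbA; case: eqVneq => //= ->.
  by rewrite (negbTE vw) (negbTE vu).
by rewrite big_setU1 ?big_set1 // inE.
Qed.

Lemma triangle_rot (v w u : V) : [set v; w; u] = [set w; v; u].
Proof. by rewrite (finset.setUC [set v]). Qed.

Lemma triangle_rot2 (v w u : V) : [set v; w; u] = [set u; v; w].
Proof. by rewrite finset.setUC finset.setUA. Qed.

Lemma inner_angle_cosine_law (R : realType) (d : {set V} -> R) (v w u : V) :
  v != w -> v != u -> w != u ->
  let f := [set v; w; u] in
  inner_angle d f v = acos (cosine_law R (d (f :\ v)) (d (f :\ w)) (d (f :\ u))).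
Proof. by move=> vw vu wu f; rewrite /inner_angle !big_other_vertices. Qed.

Lemma triangle_inner_angles (R : realType) (F : {set {set V}}) (d : {set V} ->
    R) (f : {set V}) v :
  pl_metric F d -> f \in F -> #|f| = 3%N -> v \in f ->
  (0 < inner_angle d f v) /\ \sum_(x in f) inner_angle d f x = pi.
Proof.
move=> [d0 dlt] fF c3 vf.
have dpos x : x \in f -> 0 < d (f :\ x).
  move=> xf; apply: d0; rewrite inE; apply/andP; split.
    by have := cardsD1 x f; rewrite xf c3 add1n => /eqP; rewrite eqSS eq_sym.
  by apply/exists_inP; exists f; rewrite // finset.subD1set.
have [w [u [vw vu wu fE]]] := triangle_vertices _ _ c3 vf.
have wf : w \in f by rewrite fE !inE eqxx orbT.
have uf : u \in f by rewrite fE !inE eqxx orbT.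
have wv : w != v by rewrite eq_sym.
have uv : u != v by rewrite eq_sym.
have uw : u != w by rewrite eq_sym.
have fE' : f = [set w; v; u] by rewrite fE triangle_rot.
have fE'' : f = [set u; v; w] by rewrite fE triangle_rot2.
have := dlt f fF v vf; rewrite {2}fE big_other_vertices //= => lv.
have := dlt f fF w wf; rewrite {2}fE' big_other_vertices //= => lw.
have := dlt f fF u uf; rewrite {2}fE'' big_other_vertices //= => lu.
have Av : inner_angle d f v = acos (cosine_law R (d (f :\ v)) (d (f :\ w)) (d (f :\
    u))).
  by rewrite {1 2}fE inner_angle_cosine_law // -fE.
have Aw : inner_angle d f w = acos (cosine_law R (d (f :\ w)) (d (f :\ v)) (d (f :\
    u))).
  by rewrite {1 2}fE' inner_angle_cosine_law // -fE'.
have Au : inner_angle d f u = acos (cosine_law R (d (f :\ u)) (d (f :\ v)) (d (f :\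
    w))).
  by rewrite {1 2}fE'' inner_angle_cosine_law // -fE''.
split.
  have /andP[? ?] := cosine_law_itv R _ _ _ (dpos v vf) (dpos w wf) (dpos u uf) lv lw
      lu.
  by rewrite Av; apply: acos_gt0; rewrite ltW.
rewrite {1}fE big_triangle //= Av Aw Au addrA.
by apply: triangle_angle_sum => //; apply: dpos.
Qed.

(** Three mutually tangent circles of radii [x], [y], [z]: the product on the right
    is the square of the sine of half of the angle at the first centre, and
    each of its factors decreases with [x]. *)
Lemma cosine_law_tangent (R : realType) (x y z : R) : 0 < x -> 0 < y -> 0 < z ->
  cosine_law R (y + z) (x + z) (x + y) =
  1 - 2 * ((y / (x + y)) * (z / (x + z))).
Proof.
move=> x0 y0 z0; rewrite /cosine_law; field.
by rewrite !gt_eqF // addr_gt0.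
Qed.

End TriangleVertices.

(** * Sums of angles over a set of vertices *)

Section AngleSystem.
Context (R : realType) (V : finType) (F : {set {set V}}).
Variable a : {set V} -> V -> R.
Hypothesis a_gt0 : forall f v, f \in F -> v \in f -> 0 < a f v.
Hypothesis a_sum : forall f, f \in F -> \sum_(v in f) a f v = pi.
Hypothesis vertices_connected : forall I : {set V},
  I != finset.set0 -> I \proper [set: V]%SET ->
  exists f x y, [/\ f \in F, x \in f, y \in f, x \in I & y \notin I].

Lemma exchange_angles (I : {set V}) :
  \sum_(v in I) \sum_(f in F | v \in f) a f v =
  \sum_(f in triangles_meeting F I) \sum_(v in f | v \in I) a f v.
Proof.
rewrite (exchange_big_dep (mem (triangles_meeting F I))) /=; last first.
  move=> v f vI /andP[fF vf]; rewrite inE fF; apply/exists_inP; by exists v.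
apply: eq_bigr => f; rewrite inE => /andP[fF _].
by apply: eq_bigl => v; rewrite fF /= andbC.
Qed.

Lemma angle_total : \sum_v \sum_(f in F | v \in f) a f v = pi * #|F|%:R.
Proof.
rewrite (exchange_big_dep (mem F)) //=; last by move=> v f _ /andP[].
rewrite mulr_natr -sumr_const; apply: eq_bigr => f fF.
by rewrite -(a_sum f fF); apply: eq_bigl => v; rewrite fF.
Qed.

(** A triangle meeting [I] gives at most its whole angle sum [pi] to [I], and less
    if it has a vertex outside [I]. *)
Lemma angle_sum_lt (I : {set V}) : I != finset.set0 -> I \proper [set: V]%SET ->
  \sum_(v in I) \sum_(f in F | v \in f) a f v < pi * #|triangles_meeting F I|%:R.
Proof.
move=> I0 pI; rewrite exchange_angles mulr_natr -sumr_const.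
have [f0 [x [y [f0F xf yf xI yI]]]] := vertices_connected I I0 pI.
have le f : f \in triangles_meeting F I -> \sum_(v in f | v \in I) a f v <= pi.
  rewrite inE => /andP[fF _]; rewrite -(a_sum f fF) [leRHS](bigID (mem I)) /=.
  by rewrite lerDl sumr_ge0 // => v /andP[vf _]; rewrite ltW // a_gt0.
have f0m : f0 \in triangles_meeting F I.
  by rewrite inE f0F; apply/exists_inP; exists x.
rewrite (bigD1 f0) //= [ltRHS](bigD1 f0) //=; apply: ltr_leD; last first.
  by apply: ler_sum => f /andP[/le].
rewrite -(a_sum f0 f0F) [ltRHS](bigID (mem I)) /= ltrDl.
rewrite (bigD1 y) /=; last by rewrite yf.
rewrite ltr_pwDl ?a_gt0 //.
by rewrite sumr_ge0 // => v /andP[/andP[vf _] _]; rewrite ltW // a_gt0.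
Qed.

End AngleSystem.

Local Open Scope classical_set_scope.
Local Open Scope ring_scope.

(** * Tangent circle packings with prescribed cone angles *)

Section CirclePacking.
Context (R : realType) (V : finType).
Implicit Types (r : V -> R) (f : {set V}) (v : V).

(** Edge lengths for circles of radii [r] centred at the vertices, tangent along
    the edges. *)
Definition tangency r (e : {set V}) : R := \sum_(w in e) r w.

(** [inner_angle (tangency r)] in a form that shows how it varies with the radii. *)
Definition packing_angle r f v : R :=
  acos (1 - 2 * \prod_(w in f :\ v) (r w / (r v + r w))).

Lemma inner_angle_tangency r f v : (forall v, 0 < r v) -> #|f| = 3%N -> v \in f ->
  inner_angle (tangency r) f v = packing_angle r f v.
Proof.
move=> r0 c3 vf; have [w [u [vw vu wu ->]]] := triangle_vertices _ _ _ c3 vf.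
have wv : w != v by rewrite eq_sym.
have uv : u != v by rewrite eq_sym.
have uw : u != w by rewrite eq_sym.
rewrite inner_angle_cosine_law // /packing_angle big_other_vertices //=.
rewrite /tangency big_other_vertices //= triangle_rot big_other_vertices //=.
by rewrite -triangle_rot triangle_rot2 big_other_vertices //= cosine_law_tangent.
Qed.

Lemma pl_metric_tangency (F : {set {set V}}) r :
  (forall f, f \in F -> #|f| = 3%N) -> (forall v, 0 < r v) -> pl_metric F (tangency r).
Proof.
move=> F3 r0; split=> [e|f fF v vf].
  rewrite inE => /andP[c2 _]; have /set0Pn[x xe] : e != finset.set0.
    by rewrite -card_gt0 (eqP c2).
  rewrite /tangency (bigD1 x) //= ltr_pwDl //.
  by rewrite sumr_ge0 // => w _; rewrite ltW.
have [w [u [vw vu wu ->]]] := triangle_vertices _ _ _ (F3 f fF) vf.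
have wv : w != v by rewrite eq_sym.
have uv : u != v by rewrite eq_sym.
have uw : u != w by rewrite eq_sym.
rewrite [ltRHS]big_other_vertices //= /tangency big_other_vertices //=.
rewrite triangle_rot big_other_vertices //= -triangle_rot triangle_rot2.
by rewrite big_other_vertices //=; have := r0 v; have := r0 w; have := r0 u; lra.
Qed.

Lemma ratio_itv r v w : (forall v, 0 < r v) -> 0 < r w / (r v + r w) < 1.
Proof.
move=> r0; have := r0 v; have := r0 w => rw rv.
by rewrite divr_gt0 ?addr_gt0 //= ltr_pdivrMr ?addr_gt0 // mul1r ltrDr.
Qed.

Lemma ratio_prod_itv r f v : (forall v, 0 < r v) -> #|f| = 3%N -> v \in f ->
  0 < \prod_(w in f :\ v) (r w / (r v + r w)) < 1.
Proof.
move=> r0 c3 vf; have [w [u [vw vu wu ->]]] := triangle_vertices _ _ _ c3 vf.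
rewrite big_other_vertices //=.
have /andP[w0 w1] := ratio_itv r v w r0; have /andP[u0 u1] := ratio_itv r v u r0.
by rewrite mulr_gt0 //= mulr_ilt1 // ltW.
Qed.

Lemma packing_angle_le r r' f v :
  (forall v, 0 < r v) -> (forall v, 0 < r' v) -> #|f| = 3%N -> v \in f ->
  (forall w, w \in f :\ v -> r' w / (r' v + r' w) <= r w / (r v + r w)) ->
  packing_angle r' f v <= packing_angle r f v.
Proof.
move=> r0 r'0 c3 vf le.
have /andP[p0 p1] := ratio_prod_itv r f v r0 c3 vf.
have /andP[p'0 p'1] := ratio_prod_itv r' f v r'0 c3 vf.
have : \prod_(w in f :\ v) (r' w / (r' v + r' w)) <=
       \prod_(w in f :\ v) (r w / (r v + r w)).
  apply: ler_prod => w wf; rewrite le // andbT.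
  by have /andP[/ltW] := ratio_itv r' v w r'0.
by move=> lep; apply: acos_le; lra.
Qed.

Lemma packing_angle_lt r r' f v y :
  (forall v, 0 < r v) -> (forall v, 0 < r' v) -> #|f| = 3%N -> v \in f ->
  (forall w, w \in f :\ v -> r' w / (r' v + r' w) <= r w / (r v + r w)) ->
  y \in f :\ v -> r' y / (r' v + r' y) < r y / (r v + r y) ->
  packing_angle r' f v < packing_angle r f v.
Proof.
move=> r0 r'0 c3 vf le yf lty.
have /andP[p0 p1] := ratio_prod_itv r f v r0 c3 vf.
have /andP[p'0 p'1] := ratio_prod_itv r' f v r'0 c3 vf.
have : \prod_(w in f :\ v) (r' w / (r' v + r' w)) <
       \prod_(w in f :\ v) (r w / (r v + r w)).
  rewrite (bigD1 y) //= [ltRHS](bigD1 y) //=.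
  apply: (@le_lt_trans _ _ (r' y / (r' v + r' y) *
     \prod_(i in f :\ v | i != y) (r i / (r v + r i)))).
    apply: ler_wpM2l; first by have /andP[/ltW] := ratio_itv r' v y r'0.
    apply: ler_prod => w /andP[wf _]; rewrite le // andbT.
    by have /andP[/ltW] := ratio_itv r' v w r'0.
  rewrite ltr_pM2r // prodr_gt0 // => w _.
  by have /andP[] := ratio_itv r v w r0.
by move=> ltp; apply: acos_lt; lra.
Qed.

Lemma packing_angle_scale r f v (c : R) : 0 < c ->
  packing_angle (fun w => c * r w) f v = packing_angle r f v.
Proof.
move=> c0; rewrite /packing_angle; congr (acos (1 - 2 * _)).
by apply: eq_bigr => w _; rewrite -mulrDr -mulf_div divff ?gt_eqF // mul1r.
Qed.

Lemma cvg_packing_angle (T : Type) (G : set_system T) (FG : Filter G)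
    (rho : T -> V -> R) r f v :
  (forall v, 0 < r v) -> #|f| = 3%N -> v \in f ->
  (forall v, rho t v @[t --> G] --> r v) ->
  packing_angle (rho t) f v @[t --> G] --> packing_angle r f v.
Proof.
move=> r0 c3 vf cv.
have /andP[p0 p1] := ratio_prod_itv r f v r0 c3 vf.
have : \prod_(w in f :\ v) (rho t w / (rho t v + rho t w)) @[t --> G] -->
    \prod_(w in f :\ v) (r w / (r v + r w)).
  apply: cvg_big => [|w _]; first exact: mul_continuous.
  apply: cvgM; first exact: cv.
  by apply: cvgV; [rewrite gt_eqF ?addr_gt0|apply: cvgD; exact: cv].
move=> cp; apply: (cvg_comp (fun t => 1 - 2 * \prod_(w in f :\ v) (rho t w / (rho t v
    + rho t w))) (@acos R)); last first.
  by apply: continuous_acos; lra.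
by apply: cvgB; [exact: cvg_cst|apply: cvgM; [exact: cvg_cst|]].
Qed.

End CirclePacking.

Section PrescribedConeAngles.
Context (R : realType) (V : finType) (F : {set {set V}}).
Implicit Types (r : V -> R) (f : {set V}) (v : V) (theta : V -> R).
Hypothesis triangle3 : forall f, f \in F -> #|f| = 3%N.
Hypothesis vertices_connected : forall I : {set V},
  I != finset.set0 -> I \proper [set: V]%SET ->
  exists f x y, [/\ f \in F, x \in f, y \in f, x \in I & y \notin I].

Definition cone_angle r v : R := \sum_(f in F | v \in f) packing_angle R V r f v.

Lemma packing_angle_gt0 r f v : (forall v, 0 < r v) -> f \in F -> v \in f ->
  0 < packing_angle R V r f v.
Proof.
move=> r0 fF vf; rewrite -inner_angle_tangency ?triangle3 //.
by case: (triangle_inner_angles V R F (tangency R V r) f v (pl_metric_tangency _ _ _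
    _ triangle3 r0) fF (triangle3 _ fF) vf).
Qed.

Lemma packing_angle_sum r f : (forall v, 0 < r v) -> f \in F ->
  \sum_(v in f) packing_angle R V r f v = pi.
Proof.
move=> r0 fF.
have /set0Pn[v vf] : f != finset.set0 by rewrite -card_gt0 triangle3.
have [_ <-] := triangle_inner_angles V R F (tangency R V r) f v (pl_metric_tangency _
    _ _ _ triangle3 r0) fF (triangle3 _ fF) vf.
by apply: eq_bigr => w wf; rewrite inner_angle_tangency ?triangle3.
Qed.

Lemma cone_angle_total r : (forall v, 0 < r v) ->
  \sum_v cone_angle r v = pi * #|F|%:R.
Proof. by move=> r0; apply: angle_total => f fF; apply: packing_angle_sum. Qed.

Lemma cone_angle_scale r v (c : R) : 0 < c ->
  cone_angle (fun w => c * r w) v = cone_angle r v.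
Proof. by move=> c0; apply: eq_bigr => f _; apply: packing_angle_scale. Qed.

Lemma cvg_cone_angle (T : Type) (G : set_system T) (FG : Filter G)
    (rho : T -> V -> R) r v :
  (forall v, 0 < r v) -> (forall v, rho t v @[t --> G] --> r v) ->
  cone_angle (rho t) v @[t --> G] --> cone_angle r v.
Proof.
move=> r0 cv; apply: cvg_big => [|f /andP[fF vf]]; first exact: add_continuous.
by apply: cvg_packing_angle => //; apply: triangle3.
Qed.

(** Enlarging the circles of maximal excess by a common factor close to [1]
    does not increase their cone angles, and decreases the cone angle of those
    which have a neighbour outside the family; the other excesses stay below
    the maximum by continuity.  Hence the family shrinks, as long as it is not
    empty.  It is never the whole of [V], since the excesses have sum [0]. *)
Lemma decrease_excess theta r (m : R) :
  \sum_v theta v = pi * #|F|%:R -> 0 < m -> (forall v, 0 < r v) ->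
  (forall v, cone_angle r v - theta v <= m) ->
  exists2 r' : V -> R, forall v, 0 < r' v & forall v, cone_angle r' v - theta v < m.
Proof.
move=> sum_theta m0.
have [n] := ubnP #|[set v | cone_angle r v - theta v == m]%SET|.
elim: n r => // n IHn r; set A := [set v | _]%SET => /ltnSE cA r0 le_m.
have [A0|A0] := eqVneq A finset.set0.
  exists r => // v; rewrite lt_neqAle le_m andbT.
  by have /setP/(_ v) := A0; rewrite !inE => ->.
have pA : A \proper [set: V]%SET.
  rewrite finset.properT; apply: contra_ltN m0 => /eqP AT.
  have allm v : cone_angle r v = theta v + m.
    have : v \in A by rewrite AT finset.in_setT.
    by rewrite inE => /eqP <-; ring.
  have := cone_angle_total r r0.
  under eq_bigr do rewrite allm.
  rewrite big_split /= sum_theta sumr_const -[RHS]addr0 => /addrI.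
  have /set0Pn[v _] := A0; move=> /eqP; rewrite mulrn_eq0 => /orP[|/eqP->//].
  by rewrite cardE -[_ == _]/(_ == 0)%N -cardE => /eqP/card0_eq/(_ v); rewrite inE.
have [f0 [x [y [f0F xf yf xA yA]]]] := vertices_connected A A0 pA.
pose rho (t : R) v := if v \in A then t * r v else r v.
have rho_cvg v : rho t v @[t --> (1 : R)] --> r v.
  rewrite /rho; case: (v \in A); last exact: cvg_cst.
  rewrite -[X in _ --> X]mul1r; apply: cvgM; [exact: cvg_id|exact: cvg_cst].
have near_lt v : v \notin A -> \forall t \near (1 : R),
    cone_angle (rho t) v - theta v < m.
  move=> vA; have lt_m : cone_angle r v - theta v < m.
    by rewrite lt_neqAle le_m andbT; move: vA; rewrite inE.
  have cv : cone_angle (rho t) v - theta v @[t --> (1 : R)] --> cone_angle r v -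
      theta v.
    by apply: cvgB; [exact: cvg_cone_angle|exact: cvg_cst].
  exact: (cvgr_lt (cone_angle r v - theta v) cv m lt_m).
have : \forall t \near (1 : R), forall v, v \notin A ->
    cone_angle (rho t) v - theta v < m.
  apply: (@filter_forall _ V (fun v t => v \notin A ->
      cone_angle (rho t) v - theta v < m) _ (nbhs_filter _)) => v;
      case: (boolP (v \in A)) => vA; first exact: nearW.
  by apply: filterS (near_lt v vA) => t.
move=> /nbhs_ballP[e /= e0 be].
pose t : R := 1 + e / 2.
have t1 : 1 < t by rewrite /t; lra.
have {be} out v : v \notin A -> cone_angle (rho t) v - theta v < m.
  by apply: be; rewrite /ball /= /t opprD addNKr normrN gtr0_norm; lra.
have rt0 v : 0 < rho t v.
  by rewrite /rho; case: ifP => // _; rewrite mulr_gt0 // (lt_trans ltr01).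
have ratio_le v w : v \in A -> rho t w / (rho t v + rho t w) <= r w / (r v + r w).
  rewrite /rho => ->; have := r0 v; have := r0 w => rw rv.
  have tv : 0 < t * r v by rewrite mulr_gt0 // (lt_trans ltr01).
  case: ifP => _.
    by rewrite -mulrDr -mulf_div divff ?mul1r // gt_eqF // (lt_trans ltr01).
  by rewrite ler_pM2l // lef_pV2 ?posrE ?addr_gt0 // lerD2r ler_peMl ?ltW.
have ratio_lt v w : v \in A -> w \notin A ->
    rho t w / (rho t v + rho t w) < r w / (r v + r w).
  rewrite /rho => -> /negbTE->; have := r0 v; have := r0 w => rw rv.
  have tv : 0 < t * r v by rewrite mulr_gt0 // (lt_trans ltr01).
  by rewrite ltr_pM2l // ltf_pV2 ?posrE ?addr_gt0 // ltrD2r ltr_pMl.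
have in_le v : v \in A -> cone_angle (rho t) v <= cone_angle r v.
  move=> vA; apply: ler_sum => f /andP[fF vf].
  by apply: packing_angle_le; rewrite ?triangle3 // => w _; apply: ratio_le.
have xlt : cone_angle (rho t) x < cone_angle r x.
  rewrite /cone_angle (bigD1 f0) /= ?f0F // [ltRHS](bigD1 f0) /= ?f0F //.
  apply: ltr_leD.
    apply: (packing_angle_lt _ _ _ _ _ _ y); rewrite ?triangle3 //.
    - by move=> w _; apply: ratio_le.
    - by rewrite finset.in_setD1 yf andbT; apply: contraNneq yA => ->.
    - exact: ratio_lt.
  apply: ler_sum => f /andP[/andP[fF vf] _].
  by apply: packing_angle_le; rewrite ?triangle3 // => w _; apply: ratio_le.
apply: (IHn (rho t)) => //; last first.
  move=> v; have [vA|/out/ltW//] := boolP (v \in A).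
  by apply: le_trans (le_m v); rewrite lerD2r in_le.
apply: leq_trans cA; apply: proper_card; apply/fintype.properP; split.
  apply/fintype.subsetP => v; rewrite inE => /eqP vm.
  by apply: contraT => /out; rewrite vm ltxx.
exists x => //; rewrite inE lt_eqF //.
by move: xA; rewrite inE => /eqP <-; rewrite ltrD2r.
Qed.

(** When the radii of a set of circles are tiny compared to the others, the
    angles at large circles tend to [0] in the triangles that meet both kinds,
    so that the cone angles at the small circles add up to almost [pi] times
    the number of triangles meeting them.  Among [#|V|] consecutive ranges of
    radii [lam^k.+1 <= r < lam^k], one is empty, and separates small from
    large. *)
Lemma excess_proper theta (gap delta : R) :
  0 <= delta -> #|V|%:R * delta < gap ->
  (forall I : {set V}, I != finset.set0 -> I \proper [set: V]%SET ->
    \sum_(v in I) theta v + gap <= pi * #|triangles_meeting F I|%:R) ->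
  exists2 eps : R, 0 < eps & forall r, (forall v, 0 < r v) ->
    (forall v, r v <= 1) -> (exists v, r v = 1) ->
    (forall v, cone_angle r v - theta v <= delta) -> forall v, eps <= r v.
Proof.
move=> d0 lt_gap theta_gap.
(* The angles lost to large circles, [3 * eta] per triangle, must not fill the
   part of the gap left by the excesses. *)
pose eta : R := (gap - #|V|%:R * delta) / (3 * #|F|%:R + 1).
have den0 : 0 < 3 * #|F|%:R + 1 :> R by rewrite ltr_wpDl // mulr_ge0.
have eta0 : 0 < eta by rewrite divr_gt0 // subr_gt0.
have [lam /andP[lam0 lam1] acos_lam] := acos_near1 R eta eta0.
exists (lam ^+ #|V|); first by rewrite exprn_gt0.
move=> r r0 r1 [vmax vmax1] le_delta u; rewrite leNgt; apply/negP => u_lt.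
have lamX k l : (k <= l)%N -> lam ^+ l <= lam ^+ k.
  by move=> kl; apply: ler_wiXn2l => //; exact: ltW.
have [k sep] : exists k : 'I_#|V|, forall v, r v < lam ^+ k.+1 \/ lam ^+ k <= r v.
  apply: contrapT => /forallNP no.
  have {no} ex (k : 'I_#|V|) : exists v, (lam ^+ k.+1 <= r v) && (r v < lam ^+ k).
    have /existsNP[v /not_orP[/negP h1 /negP h2]] := no k.
    by exists v; rewrite leNgt h1 ltNge h2.
  pose w k := xchoose (ex k).
  have wP (k : 'I_#|V|) : (lam ^+ k.+1 <= r (w k)) && (r (w k) < lam ^+ k) :=
      xchooseP (ex k).
  have w_lt (k l : 'I_#|V|) : (k < l)%N -> w k <> w l.
    move=> kl wkl; have /andP[_] := wP l; rewrite -wkl; apply/negP; rewrite -leNgt.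
    by apply: le_trans (lamX _ _ kl) _; case/andP: (wP k).
  have w_inj : injective w.
    move=> k l wkl; apply: val_inj => /=.
    by case: (ltngtP k l) => // /w_lt; [move=> /(_ wkl)|move=> /(_ (esym wkl))].
  have : (#|codom w| <= #|[set~ vmax]%SET|)%N.
    apply: subset_leq_card; apply/fintype.subsetP => _ /codomP[k ->].
    rewrite !inE; apply/negP => /eqP wk.
    have /andP[_] := wP k; rewrite wk vmax1 ltNge.
    by rewrite -(expr0 lam) lamX.
  rewrite card_codom // card_ord cardsC1.
  by have : (0 < #|V|)%N; [apply/card_gt0P; exists vmax|case: #|V| => // n;
      rewrite ltnn].
pose I := [set v | r v < lam ^+ k.+1]%SET.
have uI : u \in I by rewrite inE (lt_le_trans u_lt) // lamX.
have I0 : I != finset.set0 by apply/set0Pn; exists u.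
have pI : I \proper [set: V]%SET.
  apply/fintype.properP; split; first exact: finset.subsetT.
  exists vmax; rewrite ?finset.in_setT // inE vmax1 -leNgt -(expr0 lam); exact: lamX.
have small f v : f \in triangles_meeting F I -> v \in f -> v \notin I ->
    packing_angle R V r f v <= eta.
  rewrite inE => /andP[fF /exists_inP[w wI wf]] vf vI; apply: acos_lam.
  have /andP[p0 p1] := ratio_prod_itv R V r f v r0 (triangle3 _ fF) vf.
  suff : \prod_(w in f :\ v) (r w / (r v + r w)) <= lam by lra.
  have wv : w != v by apply: contraNneq vI => <-.
  rewrite (bigD1 w) /=; last by rewrite finset.in_setD1 wv.
  rewrite -[leRHS]mulr1; apply: ler_pM.
  - by have /andP[/ltW] := ratio_itv R V r v w r0.
  - by apply: prodr_ge0 => x _; have /andP[/ltW] := ratio_itv R V r v x r0.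
  - have := r0 v; have := r0 w => rw rv.
    rewrite ler_pdivrMr ?addr_gt0 //.
    have : r w < lam * r v.
      move: wI; rewrite inE => /lt_le_trans; apply.
      by rewrite exprS ler_pM2l //; case: (sep v) => // vlt; move: vI; rewrite inE vlt.
    have : 0 < lam * r w by rewrite mulr_gt0.
    by rewrite mulrDr; lra.
  - apply: prodr_ile1 => x _; have /andP[/ltW -> /ltW ->] := ratio_itv R V r v x r0.
    by [].
have large f : f \in triangles_meeting F I ->
    pi - 3 * eta <= \sum_(v in f | v \in I) packing_angle R V r f v.
  move=> fm; have fF : f \in F by move: fm; rewrite inE => /andP[].
  rewrite -(packing_angle_sum r f r0 fF) [X in X - _](bigID (mem I)) /=.
  rewrite -addrA gerDl subr_le0.
  apply: (@le_trans _ _ (\sum_(v in f) eta)).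
    rewrite [leRHS](bigID (mem I)) /= addrC; apply: ler_wpDr.
      by rewrite sumr_ge0 // => *; exact: ltW.
    by apply: ler_sum => v /andP[vf vI]; apply: small.
  by rewrite sumr_const (triangle3 f fF) mulr_natl.
have lower : (pi - 3 * eta) * #|triangles_meeting F I|%:R <=
    \sum_(v in I) cone_angle r v.
  rewrite exchange_angles // mulr_natr -sumr_const.
  by rewrite ler_sum.
have upper : \sum_(v in I) cone_angle r v <= \sum_(v in I) theta v + #|V|%:R * delta.
  apply: (@le_trans _ _ (\sum_(v in I) (theta v + delta))).
    by apply: ler_sum => v _; have := le_delta v; lra.
  rewrite big_split /= lerD2l sumr_const -[leLHS]mulr_natl ler_wpM2r // ler_nat.
  exact: max_card.
have FI : #|triangles_meeting F I|%:R <= #|F|%:R :> R.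
  by rewrite ler_nat subset_leq_card //; apply/fintype.subsetP => f;
      rewrite inE => /andP[].
have eta_den : eta * (3 * #|F|%:R + 1) = gap - #|V|%:R * delta.
  by rewrite /eta divfK // gt_eqF.
have : eta * #|triangles_meeting F I|%:R <= eta * #|F|%:R by rewrite ler_pM2l.
have := theta_gap I I0 pI.
move: lower upper eta_den eta0; lra.
Qed.

Lemma normalize_radii r : (forall v, 0 < r v) -> V ->
  exists c : R, [/\ 0 < c, forall v, c * r v <= 1 & exists v, c * r v = 1].
Proof.
move=> r0 v0; pose vm := [arg max_(v > v0) r v]%O.
have vmP v : r v <= r vm by rewrite /vm; case: arg_maxP => // i _ /(_ v); apply.
exists (r vm)^-1; split.
- by rewrite invr_gt0.
- by move=> v; rewrite ler_pdivrMl // mulr1.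
- by exists vm; rewrite mulVf // gt_eqF.
Qed.

(** The maximal excess attains its minimum on a box that contains all
    normalised radii of small excess; it can be decreased as long as it is
    positive.  Since the excesses have sum [0], they all vanish at a minimum. *)
Lemma prescribed_cone_angles_near theta (gap delta : R) r :
  \sum_v theta v = pi * #|F|%:R ->
  0 <= delta -> #|V|%:R * delta < gap ->
  (forall I : {set V}, I != finset.set0 -> I \proper [set: V]%SET ->
    \sum_(v in I) theta v + gap <= pi * #|triangles_meeting F I|%:R) ->
  (forall v, 0 < r v) -> (forall v, cone_angle r v - theta v <= delta) ->
  exists2 r', forall v, 0 < r' v & forall v, cone_angle r' v = theta v.
Proof.
move=> sum_theta d0 lt_gap theta_gap r0 r_delta.
have [|/card_gt0P[v0 _]] := posnP #|V|.
  by move=> /card0_eq V0; exists r => // v; have := V0 v; rewrite inE.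
have [eps eps0 proper] := excess_proper theta gap delta d0 lt_gap theta_gap.
pose box : set (prod_topology (fun _ : V => R)) :=
    [set r | forall v, `[eps, 1]%classic (r v)].
pose Phi (r : prod_topology (fun _ : V => R)) : R :=
  \big[Num.max/0]_v (cone_angle r v - theta v).
have Phi_ge (s : V -> R) v : cone_angle s v - theta v <= Phi s.
  by apply: (@le_bigmax _ _ _ _ (fun v => cone_angle s v - theta v)).
have into_box (s : V -> R) : (forall v, 0 < s v) ->
    (forall v, cone_angle s v - theta v <= delta) ->
    exists2 s' : V -> R, box s' & forall v, cone_angle s' v = cone_angle s v.
  move=> s0 sd; have [c [c0 c1 cm]] := normalize_radii s s0 v0.
  exists (fun v => c * s v); last by move=> v; apply: cone_angle_scale.
  move=> v; rewrite /= in_itv /= c1 andbT; move: v; apply: proper => //.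
    by move=> v; rewrite mulr_gt0.
  by move=> v; rewrite cone_angle_scale.
have [r1 r1box r1E] := into_box r r0 r_delta.
have box_gt0 s : box s -> forall v, 0 < s v.
  by move=> sb v; have := sb v; rewrite /= in_itv /= => /andP[/(lt_le_trans eps0)].
have Phi_cont : {within box, continuous Phi}.
  apply: continuous_in_subspaceT => s; rewrite inE => /box_gt0 s0.
  have max_cont : continuous (fun x : R * R => Num.max x.1 x.2).
    by move=> x; apply: continuous_max; [exact: cvg_fst|exact: cvg_snd].
  apply: (@cvg_big R V Num.max 0 xpredT max_cont _ (nbhs s) _
    (fun v r => cone_angle r v - theta v) (fun v => cone_angle s v - theta v)) => v _.
  apply: cvgB; last exact: cvg_cst.
  apply: cvg_cone_angle => // w; exact: (@proj_continuous V (fun=> R) w s).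
have box_compact : compact box.
  by apply: (tychonoff (fun _ : V => @segment_compact R eps 1)).
have box0 : box !=set0 by exists r1.
have [r2] := compact_EVT_min box0 box_compact Phi_cont.
rewrite inE => r2box r2min; have r20 := box_gt0 _ r2box.
have Phi_r2 : Phi r2 <= delta.
  apply: le_trans (r2min r1 _) _; first by rewrite inE.
  by apply: bigmax_le => // v _; rewrite r1E.
have [Phi0|Phi0] := ltP 0 (Phi r2).
  have [r3 r30 r3lt] := decrease_excess theta r2 (Phi r2) sum_theta Phi0 r20 (Phi_ge
      r2).
  have [|r4 r4box r4E] := into_box r3 r30.
    by move=> v; apply: le_trans Phi_r2; exact: ltW.
  suff : Phi r4 < Phi r2 by rewrite ltNge r2min // inE.
  by apply/bigmax_ltP; split=> // v _; rewrite r4E.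
have exc_le v : cone_angle r2 v - theta v <= 0 by apply: le_trans (Phi_ge _ _) Phi0.
exists r2 => // v; apply/eqP; rewrite -subr_eq0; apply/eqP.
have sum0 : \sum_v (theta v - cone_angle r2 v) = 0.
  by rewrite sumrB sum_theta cone_angle_total // subrr.
have /psumr_eq0P : forall v, v \in V -> 0 <= theta v - cone_angle r2 v.
  by move=> w _; have := exc_le w; lra.
by move=> /(_ sum0 v isT); lra.
Qed.

Lemma uniform_gap (T : finType) (P : pred T) (h : T -> R) :
  (forall x, P x -> 0 < h x) -> exists2 g : R, 0 < g & forall x, P x -> g <= h x.
Proof.
move=> h0; exists (\big[Num.min/1]_(x | P x) h x).
  by apply/bigmin_gtP.
by move=> x Px; apply: bigmin_le_cond.
Qed.

(** Thurston's description of the cone angles of tangent circle packings.  The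
    admissible cone angles form a convex set, and the segment from those of
    the packing with unit radii is followed in small steps. *)
Theorem prescribed_cone_angles theta :
  \sum_v theta v = pi * #|F|%:R ->
  (forall I : {set V}, I != finset.set0 -> I \proper [set: V]%SET ->
    \sum_(v in I) theta v < pi * #|triangles_meeting F I|%:R) ->
  exists2 r, forall v, 0 < r v & forall v, cone_angle r v = theta v.
Proof.
move=> sum_theta theta_lt.
pose one := fun _ : V => 1 : R.
have one0 v : 0 < one v by [].
pose theta0 := cone_angle one.
have sum_theta0 : \sum_v theta0 v = pi * #|F|%:R by exact: cone_angle_total.
have theta0_lt (I : {set V}) : I != finset.set0 -> I \proper [set: V]%SET ->
    \sum_(v in I) theta0 v < pi * #|triangles_meeting F I|%:R.
  apply: (angle_sum_lt _ _ _ (packing_angle R V one)) => //.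
  - by move=> *; apply: packing_angle_gt0.
  - by move=> *; apply: packing_angle_sum.
pose P (I : {set V}) := (I != finset.set0) && (I \proper [set: V]%SET).
have [g1 g10 g1P] := uniform_gap _ P
  (fun I => pi * #|triangles_meeting F I|%:R - \sum_(v in I) theta v)
  ltac:(by move=> I /andP[? ?]; rewrite subr_gt0 theta_lt).
have [g2 g20 g2P] := uniform_gap _ P
  (fun I => pi * #|triangles_meeting F I|%:R - \sum_(v in I) theta0 v)
  ltac:(by move=> I /andP[? ?]; rewrite subr_gt0 theta0_lt).
pose g := Num.min g1 g2.
have g0 : 0 < g by rewrite lt_min g10.
pose C : R := \sum_v `|theta0 v - theta v|.
have CP v : theta0 v - theta v <= C.
  by apply: le_trans (ler_norm _) _; rewrite /C (bigD1 v) //= lerDl sumr_ge0.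
have C0 : 0 <= C by rewrite sumr_ge0.
(* A step changes no target angle by more than [C / N], small compared to
   the gap divided by the number of vertices. *)
pose N := (Num.truncn (#|V|%:R * C / g)).+1.
have N0 : 0 < N%:R :> R by rewrite ltr0n.
have NP : #|V|%:R * (C / N%:R) < g.
  have : #|V|%:R * C / g < N%:R by apply: truncnS_gt.
  by rewrite ltr_pdivrMr // => lt_N; rewrite mulrA ltr_pdivrMr // [g * _]mulrC.
pose th (k : nat) v := theta0 v + (k%:R / N%:R) * (theta v - theta0 v).
have path k : (k <= N)%N -> exists2 r : V ->
    R, forall v, 0 < r v & forall v, cone_angle r v = th k v.
  elim: k => [|k IHk] kN.
    by exists one => // v; rewrite /th mul0r mul0r addr0.
  have [r r0 rE] := IHk (ltnW kN).
  have k01 : 0 <= (k.+1%:R / N%:R : R) <= 1.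
    by rewrite divr_ge0 //= ler_pdivrMr // mul1r ler_nat.
  have thS (Q : pred V) : \sum_(v | Q v) th k.+1 v = (1 - k.+1%:R / N%:R) * \sum_(v |
      Q v) theta0 v
      + k.+1%:R / N%:R * \sum_(v | Q v) theta v.
    rewrite !mulr_sumr -big_split /=; apply: eq_bigr => v _; rewrite /th; ring.
  apply: (prescribed_cone_angles_near _ g (C / N%:R) r) => //.
  - by rewrite thS sum_theta sum_theta0; ring.
  - by rewrite divr_ge0.
  - move=> I I0 pI; rewrite thS.
    have PI : P I by rewrite /P I0.
    have := g1P I PI; have := g2P I PI; have : g <= g1 by rewrite ge_min lexx.
    have : g <= g2 by rewrite ge_min lexx orbT.
    move: k01; move: (_ / _) => s; move: (\sum_(_ in _) _) (\sum_(_ in _) _) (pi * _)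
        => a b c.
    nra.
  - move=> v; rewrite rE /th.
    have -> : k.+1%:R / N%:R = k%:R / N%:R + N%:R^-1 :> R by rewrite -natr1 mulrDl
        mul1r.
    rewrite [leLHS](_ : _ = (theta0 v - theta v) / N%:R); last by ring.
    by rewrite ler_pM2r ?invr_gt0.
have [r r0 rE] := path N (leqnn _); exists r => // v.
by rewrite rE /th divff ?gt_eqF //; ring.
Qed.

End PrescribedConeAngles.

(** * Zeros of maps of the square *)

(** Sperner's lemma on a square grid: label a point [0] if [a] holds there, else
    [1] or [2] according to [b], and count modulo 2 the sides with labels [1]
    and [2].  A row of cells without three labels has as many such sides above
    as below, up to those at its left end, where the labels pass from [2] to
    [1] an odd number of times. *)
Lemma sperner_grid (n : nat) (a b : nat -> nat -> bool) :
  (forall j, j <= n -> ~~ a 0 j)%N -> (forall j, j <= n -> a n j)%N ->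
  (forall i, i <= n -> ~~ b i 0)%N -> (forall i, i <= n -> b i n)%N ->
  exists i j, [/\ (i < n)%N, (j < n)%N &
    exists c : bool -> bool * bool, exists c' : bool -> bool * bool,
      forall s, a (i + (c s).1)%N (j + (c s).2)%N = s /\
                b (i + (c' s).1)%N (j + (c' s).2)%N = s].
Proof.
move=> a0 a1 b0 b1.
pose w i j i' j' := [&& ~~ a i j, ~~ a i' j' & b i j (+) b i' j'].
apply: contrapT => no.
have cell i j : (i < n)%N -> (j < n)%N ->
    w i j i.+1 j (+) w i.+1 j i.+1 j.+1 = w i j i j.+1 (+) w i j.+1 i.+1 j.+1.
  move=> iN jN; apply: contrapT => ne; apply: no; exists i, j; split=> //.
  pose P := [:: (false, false); (true, false); (false, true); (true, true)].
  have find (h : bool * bool -> bool) : has h P ->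
      has (fun x : bool * bool => ~~ h x) P ->
      exists c : bool -> bool * bool, forall s, h (c s) = s.
    move=> /hasP[x _ hx] /hasP[y _ hy].
    exists (fun s : bool => if s then x else y); case => //; exact/negbTE.
  suff [[ha1 ha2] [hb1 hb2]] :
    (has (fun x : bool * bool => a (i + x.1)%N (j + x.2)%N) P /\
     has (fun x : bool * bool => ~~ a (i + x.1)%N (j + x.2)%N) P) /\
    (has (fun x : bool * bool => b (i + x.1)%N (j + x.2)%N) P /\
     has (fun x : bool * bool => ~~ b (i + x.1)%N (j + x.2)%N) P).
    have [c cP] := find _ ha1 ha2; have [c' c'P] := find _ hb1 hb2.
    by exists c, c' => s; split; [exact: cP|exact: c'P].
  rewrite /= !addn0 !addn1.
  move: ne; rewrite /w.
  by case: (a i j); case: (a i.+1 j); case: (a i j.+1); case: (a i.+1 j.+1);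
     case: (b i j); case: (b i.+1 j); case: (b i j.+1); case: (b i.+1 j.+1).
pose row j m := \big[addb/false]_(0 <= i < m) w i j i.+1 j.
have rowE j m : (j < n)%N -> (m <= n)%N ->
    row j m (+) row j.+1 m = w 0 j 0 j.+1 (+) w m j m j.+1.
  move=> jn; elim: m => [|m IHm] mn.
    by rewrite /row !big_geq //= addbb.
  rewrite /row !big_nat_recr //= -/(row j m) -/(row j.+1 m).
  have := cell m j mn jn; have := IHm (ltnW mn).
  move: (row j m) (row j.+1 m) (w 0 j 0 j.+1) (w m j m j.+1) => r r' u u'.
  move: (w m j m.+1 j) (w m.+1 j m.+1 j.+1) (w m j.+1 m.+1 j.+1) => h h' h''.
  by case: r; case: r'; case: u; case: u'; case: h; case: h'; case: h''.
have left_end j : (j <= n)%N -> row j n (+) b 0%N j = row 0%N n (+) b 0%N 0%N.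
  elim: j => // j IHj jn; rewrite -(IHj (ltnW jn)).
  have := rowE j n jn (leqnn n); rewrite /w (a1 _ (ltnW jn)) (a0 _ (ltnW jn)) (a0 _
      jn) /=.
  move: (row j n) (row j.+1 n) (b 0%N j) (b 0%N j.+1) => r r' u u'.
  by case: r; case: r'; case: u; case: u'.
have row0 j : (forall i, (i <= n)%N -> b i j = b 0%N j) -> row j n = false.
  move=> bj; rewrite /row big_nat big1 // => i /andP[_ iN].
  by rewrite /w (bj _ iN) (bj _ (ltnW iN)) addbb !andbF.
have := left_end n (leqnn n); rewrite !row0.
- by rewrite (b1 0%N (leq0n n)) (negbTE (b0 0%N (leq0n n))).
- by move=> i iN; rewrite (negbTE (b0 i iN)) (negbTE (b0 0%N (leq0n n))).
- by move=> i iN; rewrite (b1 i iN) (b1 0%N (leq0n n)).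
Qed.

Section PoincareMiranda.
Context (R : realType).

Definition square : set (R * R) := `[-1, 1]%classic `*` `[-1, 1]%classic.

Lemma squareP (x : R * R) : square x <-> -1 <= x.1 <= 1 /\ -1 <= x.2 <= 1.
Proof. by rewrite /square /= !in_itv. Qed.

Lemma square_compact : compact square.
Proof. by apply: compact_setX; exact: segment_compact. Qed.

Lemma sign_change_nearby (g1 g2 : R * R -> R) (n : nat) : (0 < n)%N ->
  (forall s, -1 <= s <= 1 -> [/\ g1 (-1, s) < 0, 0 < g1 (1, s),
     g2 (s, -1) < 0 & 0 < g2 (s, 1)]) ->
  exists2 u, square u & forall s : bool, exists y z : R * R,
    [/\ `|y.1 - u.1| <= 2 / n%:R /\ `|y.2 - u.2| <= 2 / n%:R,
        `|z.1 - u.1| <= 2 / n%:R /\ `|z.2 - u.2| <= 2 / n%:R,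
        (0 < g1 y) = s & (0 < g2 z) = s].
Proof.
move=> n0 bd; pose p (i : nat) : R := -1 + 2 * i%:R / n%:R.
have nR : 0 < n%:R :> R by rewrite ltr0n.
have p_itv i : (i <= n)%N -> -1 <= p i <= 1.
  move=> iN; rewrite /p lerDl mulr_ge0 ?invr_ge0 ?mulr_ge0 //=.
  have : i%:R / n%:R <= 1 :> R by rewrite ler_pdivrMr // mul1r ler_nat.
  by rewrite -mulrA; lra.
have p0 : p 0%N = -1 by rewrite /p mulr0 mul0r addr0.
have pn : p n = 1 by rewrite /p mulfK ?gt_eqF //; ring.
have [] := sperner_grid n (fun i j => 0 < g1 (p i, p j)) (fun i j => 0 < g2 (p i, p j)).
- by move=> j /p_itv/bd[? _ _ _]; rewrite p0 -leNgt ltW.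
- by move=> j /p_itv/bd[_ ? _ _]; rewrite pn.
- by move=> j /p_itv/bd[_ _ ? _]; rewrite p0 -leNgt ltW.
- by move=> j /p_itv/bd[_ _ _ ?]; rewrite pn.
move=> i [j [iN jN [c [c' cP]]]].
exists (p i, p j); first by apply/squareP; split; exact/p_itv/ltnW.
have near_p k (e : bool) : `|p (k + e)%N - p k| <= 2 / n%:R.
  rewrite /p; have -> : -1 + 2 * (k + e)%:R / n%:R - (-1 + 2 * k%:R / n%:R) = 2 /
      n%:R * e%:R :> R.
    by rewrite natrD; field; rewrite gt_eqF.
  case: e; rewrite ?mulr1 ?mulr0 ?normr0 ?divr_ge0 // ger0_norm // divr_ge0 //.
move=> s; have [aP bP] := cP s.
exists (p (i + (c s).1)%N, p (j + (c s).2)%N), (p (i + (c' s).1)%N, p (j + (c' s).2)%N).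
by split; [split; exact: near_p|split; exact: near_p|exact: aP|exact: bP].
Qed.

(** A cluster point of the cells where both functions change sign, for finer
    and finer grids, is a common zero. *)
Theorem poincare_miranda (g1 g2 : R * R -> R) :
  continuous g1 -> continuous g2 ->
  (forall s, -1 <= s <= 1 -> [/\ g1 (-1, s) < 0, 0 < g1 (1, s),
     g2 (s, -1) < 0 & 0 < g2 (s, 1)]) ->
  exists2 x, square x & g1 x = 0 /\ g2 x = 0.
Proof.
move=> cg1 cg2 bd.
pose cell n u := forall s : bool, exists y z : R * R,
    [/\ `|y.1 - u.1| <= 2 / n.+1%:R /\ `|y.2 - u.2| <= 2 / n.+1%:R,
        `|z.1 - u.1| <= 2 / n.+1%:R /\ `|z.2 - u.2| <= 2 / n.+1%:R,
        (0 < g1 y) = s & (0 < g2 z) = s].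
have /choice[u uP] : forall n : nat, exists u, square u /\ cell n u.
  by move=> n; have [u ? ?] := sign_change_nearby g1 g2 n.+1 isT bd; exists u.
have [] := square_compact (u @ \oo) _.
  by exists 0%N => // n _ /=; have [] := uP n.
move=> x [xsq clx]; exists x => //.
have close (N : set (R * R)) : nbhs x N ->
    forall s, exists y z, [/\ N y, N z, (0 < g1 y) = s & (0 < g2 z) = s].
  move=> /nbhs_ballP[e /= e0 be] s.
  pose m := Num.truncn (4 / e).
  have me n : (m <= n)%N -> 2 / n.+1%:R < e / 2.
    move=> mn; have : 4 / e < n.+1%:R.
      by apply: lt_le_trans (truncnS_gt _) _; rewrite ler_nat.
    by rewrite ltr_pdivrMr // ltr_pdivrMr // => ?; lra.
  have [||_ [[n mn <-] /= xn]] := clx [set u n | n in [set n | (m <= n)%N]] (ball x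
      (e / 2)).
  - by exists m => // n mn; exists n.
  - by apply: nbhsx_ballx; rewrite divr_gt0.
  have [_ /(_ s)[y [z [[y1 y2] [z1 z2] gy gz]]]] := uP n.
  have tri (a b c : R) : `|a - b| < e / 2 -> `|c - b| <= 2 / n.+1%:R -> `|a - c| < e.
    move=> ab cb; apply: le_lt_trans (ler_distD b _ _) _.
    rewrite [`|b - c|]distrC [ltRHS](splitr e).
    by apply: ltrD => //; apply: le_lt_trans cb _; exact: me.
  move: xn => [/= x1 x2].
  by exists y, z; split=> //; apply: be; split=> /=;
      [exact: tri y1|exact: tri y2|exact: tri z1|exact: tri z2].
split; apply/eqP; rewrite eq_le !leNgt; apply/andP; split; apply/negP => gx.
- have [|y [z [/= Ny _ gy _]]] := close [set y | 0 < g1 y] _ false;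
    last by rewrite Ny in gy.
  exact: (cvgr_gt (g1 x) (cg1 x) 0 gx).
- have [|y [z [/= Ny _ gy _]]] := close [set y | g1 y < 0] _ true.
    exact: (cvgr_lt (g1 x) (cg1 x) 0 gx).
  by have := lt_trans gy Ny; rewrite ltxx.
- have [|y [z [/= _ Nz _ gz]]] := close [set y | 0 < g2 y] _ false;
    last by rewrite Nz in gz.
  exact: (cvgr_gt (g2 x) (cg2 x) 0 gx).
- have [|y [z [/= _ Nz _ gz]]] := close [set y | g2 y < 0] _ true.
    exact: (cvgr_lt (g2 x) (cg2 x) 0 gx).
  by have := lt_trans gz Nz; rewrite ltxx.
Qed.

End PoincareMiranda.

(** * Invariance of domain in the plane *)

Section InvarianceOfDomain.
Context (R : realType).
Implicit Types (x y : R * R) (f : R * R -> R * R).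

Lemma plane_normE x : `|x| = Num.max `|x.1| `|x.2|.
Proof. by rewrite prod_normE. Qed.

Lemma plane_norm_le x (e : R) : (`|x| <= e) = (`|x.1| <= e) && (`|x.2| <= e).
Proof. by rewrite plane_normE ge_max. Qed.

Lemma plane_norm_lt x (e : R) : (`|x| < e) = (`|x.1| < e) && (`|x.2| < e).
Proof. by rewrite plane_normE gt_max. Qed.

Lemma fst_norm_le x : `|x.1| <= `|x|.
Proof. by rewrite plane_normE le_max lexx. Qed.

Lemma snd_norm_le x : `|x.2| <= `|x|.
Proof. by rewrite plane_normE le_max lexx orbT. Qed.

Lemma square_norm x : square R x <-> `|x| <= 1.
Proof. by rewrite squareP plane_norm_le !ler_norml; split=> [[-> ->]|/andP[]]. Qed.

Lemma cvg_plane (T : Type) (G : set_system T) (FG : Filter G) (h : T -> R * R)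
    (l : R * R) :
  (h t).1 @[t --> G] --> l.1 -> (h t).2 @[t --> G] --> l.2 -> h t @[t --> G] --> l.
Proof.
move=> /cvgrPdist_lt h1 /cvgrPdist_lt h2; apply/cvgrPdist_lt => e e0.
by apply: filterS2 (h1 e e0) (h2 e e0) => t ? ?; rewrite plane_norm_lt; apply/andP.
Qed.

(** The retraction onto the square, which turns maps of the square into maps of
    the plane. *)
Definition clamp x : R * R :=
  (Num.max (-1) (Num.min 1 x.1), Num.max (-1) (Num.min 1 x.2)).

Lemma clamp_square x : square R (clamp x).
Proof.
by apply/squareP; rewrite /= !le_max !lexx !ge_max !ge_min !lexx /= !andbT; split; lra.
Qed.

Lemma clamp_id x : square R x -> clamp x = x.
Proof.
case: x => x1 x2 /squareP[/= /andP[? ?] /andP[? ?]].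
by rewrite /clamp /= !min_r ?max_r.
Qed.

Lemma clamp_continuous : continuous clamp.
Proof.
have clamp1 : continuous (fun t : R => Num.max (-1) (Num.min 1 t)).
  move=> t; apply: (@continuous_max R R (fun=> -1) (fun t => Num.min 1 t)).
    exact: (@cst_continuous R R (-1) t).
  apply: (@continuous_min R R (fun=> 1) id); last exact: cvg_id.
  exact: (@cst_continuous R R 1 t).
move=> x; apply: cvg_plane.
  by apply: (@continuous_comp _ _ _ fst (fun t : R => Num.max (-1) (Num.min 1 t)) x);
      [exact: cvg_fst|exact: clamp1].
by apply: (@continuous_comp _ _ _ snd (fun t : R => Num.max (-1) (Num.min 1 t)) x);
    [exact: cvg_snd|exact: clamp1].
Qed.

(** Quantitative continuity of the inverse, by compactness. *)
Lemma inverse_modulus f (delta : R) : continuous f -> {in square R &, injective f} ->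
  0 < delta -> exists2 L : R, 0 < L &
  forall x x', square R x -> square R x' -> `|x - x'| - delta <= L * `|f x - f x'|.
Proof.
move=> cf inj d0.
pose D := (square R `*` square R) `&` [set z : (R * R) * (R * R) | delta <= `|z.1 -
    z.2|].
have dist_cont : continuous (fun z : (R * R) * (R * R) => `|z.1 - z.2|).
  by move=> z; apply: cvg_norm; apply: cvgB; [exact: cvg_fst|exact: cvg_snd].
have cD : compact D.
  apply: compact_closedI; first by apply: compact_setX; exact: square_compact.
  by have /continuous_closedP/(_ _ (@closed_ge R delta)) := dist_cont.
have [[z0 Dz0]|D0] := pselect (D !=set0); last first.
  exists 1 => // x x' xs x's; apply: (@le_trans _ _ 0); last by rewrite mulr_ge0.
  rewrite subr_le0 leNgt; apply/negP => /ltW lt.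
  by apply: D0; exists (x, x').
have fdist_cont : continuous (fun z : (R * R) * (R * R) => `|f z.1 - f z.2|).
  move=> z; apply: cvg_norm; apply: cvgB.
    by apply: (@continuous_comp _ _ _ fst f z); [exact: cvg_fst|exact: cf].
  by apply: (@continuous_comp _ _ _ snd f z); [exact: cvg_snd|exact: cf].
have [z] := compact_EVT_min (ex_intro _ z0 Dz0 : D !=set0) cD (continuous_subspaceT
    fdist_cont).
rewrite inE => -[[/= z1 z2] zd] zmin.
have m0 : 0 < `|f z.1 - f z.2|.
  rewrite normr_gt0 subr_eq0; apply/eqP => /inj.
  rewrite !inE => /(_ z1 z2) zz; move: zd; rewrite zz subrr normr0.
  by rewrite leNgt d0.
exists (2 / `|f z.1 - f z.2|); first by rewrite divr_gt0.
move=> x x' xs x's; have [lt|le] := ltP `|x - x'| delta.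
  apply: (@le_trans _ _ 0); first by rewrite subr_le0 ltW.
  by rewrite mulr_ge0 // divr_ge0.
have := zmin (x, x'); rewrite inE => /(_ (conj (conj xs x's) le)) /= le_m.
apply: (@le_trans _ _ 2).
  apply: (@le_trans _ _ `|x - x'|); first by rewrite gerBl ltW.
  apply: le_trans (ler_normB _ _) _.
  by move: xs x's => /square_norm ? /square_norm ?; lra.
by rewrite -mulrA ler_peMr // mulrC ler_pdivlMr // mul1r.
Qed.

(** Inf-convolution: [H] is the largest [L]-Lipschitz function such that [H (f x)]
    is at most [p x].  With [p] a coordinate, [H] is a coordinate of an
    approximate inverse of [f]. *)
Lemma lipschitz_extension f (p : R * R -> R) (L delta : R) :
  0 <= L -> (forall x, square R x -> `|p x| <= 1) ->
  (forall x x', square R x -> square R x' -> p x - p x' - delta <= L * `|f x - f x'|) ->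
  exists H : R * R -> R, (forall y y', `|H y - H y'| <= L * `|y - y'|) /\
    forall x, square R x -> p x - delta <= H (f x) <= p x.
Proof.
move=> L0 p1 pL.
pose E y := [set p x + L * `|y - f x| | x in square R].
have sq0 : square R (0, 0) by apply/square_norm; rewrite plane_norm_le /= normr0 ler01.
have E0 y : E y !=set0 by exists (p (0, 0) + L * `|y - f (0, 0)|); exists (0, 0).
have Elb y : has_lbound (E y).
  exists (-1) => _ [x xs <-]; have := p1 x xs; rewrite ler_norml => /andP[h _].
  by apply: ler_wpDr => //; rewrite mulr_ge0.
exists (fun y => inf (E y)); split; last first.
  move=> x xs; apply/andP; split.
    apply: lb_le_inf => // _ [x' x's <-]; have := pL x x' xs x's; lra.
  apply: ge_inf => //; exists x => //.
  by rewrite subrr normr0 mulr0 addr0.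
have half y y' : inf (E y) - inf (E y') <= L * `|y - y'|.
  rewrite lerBlDr addrC -lerBlDr; apply: lb_le_inf => // _ [x xs <-].
  rewrite lerBlDr; apply: (@le_trans _ _ (p x + L * `|y - f x|)).
    by apply: ge_inf => //; exists x.
  rewrite -addrA lerD2l -mulrDr ler_wpM2l //.
  by apply: le_trans (ler_distD y' _ _) _; rewrite addrC.
move=> y y'; rewrite ler_norml half andbT lerNl opprB.
by rewrite distrC; exact: half.
Qed.

(** Cut the four curves into [4 * (N + 1)] arcs of diameter at most [2 * C / N].
    An arc contains at most one point of a square grid of larger mesh, so that
    the arcs do not exhaust a grid with more points than there are arcs. *)
Lemma lipschitz_curves_avoid (h : bool * bool -> R -> R * R) (C tau : R) :
  0 < tau -> 0 <= C ->
  (forall k t t', `|h k t - h k t'| <= C * `|t - t'|) ->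
  exists2 s : R * R, `|s| < tau & forall k t, -1 <= t <= 1 -> h k t <> s.
Proof.
move=> tau0 C0 hC; apply: contrapT => no.
pose K := (Num.truncn (8 * C / tau)).+1.
have K0 : 0 < K%:R :> R by rewrite ltr0n.
have CK : 8 * C < tau * K%:R.
  have : 8 * C / tau < K%:R by apply: truncnS_gt.
  by rewrite ltr_pdivrMr // [tau * _]mulrC.
(* [M ^ 2 = 16 * N] grid points, of mesh [tau / M = tau * K / (4 * N)]. *)
pose M := (4 * K)%N; pose N := (K * K)%N.
have N0 : 0 < N%:R :> R by rewrite ltr0n muln_gt0.
have M0 : 0 < M%:R :> R by rewrite ltr0n muln_gt0.
pose s (a : 'I_M * 'I_M) : R * R := (tau * a.1%:R / M%:R, tau * a.2%:R / M%:R).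
have s_lt a : `|s a| < tau.
  have lt1 (i : 'I_M) : `|tau * i%:R / M%:R| < tau.
    rewrite ger0_norm ?divr_ge0 ?mulr_ge0 // ?ltW //.
    by rewrite ltr_pdivrMr // ltr_pM2l // ltr_nat.
  by rewrite plane_norm_lt !lt1.
have hit a : exists kt : (bool * bool) * R, -1 <= kt.2 <= 1 /\ h kt.1 kt.2 = s a.
  apply: contrapT => nohit; apply: no; exists (s a) => // k t t1 hs.
  by apply: nohit; exists (k, t).
have [kt ktP] := choice hit.
pose j (t : R) := Num.truncn ((t + 1) * N%:R / 2).
have jP t : -1 <= t <= 1 -> (j t < N.+1)%N /\
    (j t)%:R <= (t + 1) * N%:R / 2 < (j t).+1%:R.
  move=> /andP[t1 t2]; have u0 : 0 <= (t + 1) * N%:R / 2.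
    by rewrite divr_ge0 // mulr_ge0 //; lra.
  have jt := truncn_itv u0; split=> //.
  rewrite ltnS -(ler_nat R); apply: le_trans (proj1 (andP jt)) _.
  rewrite ler_pdivrMr // mulrC ler_pM2l //; lra.
pose g a : (bool * bool) * 'I_N.+1 := ((kt a).1, inord (j (kt a).2)).
have g_inj : injective g.
  move=> a b [gk /(congr1 val)].
  have [ta ha] := ktP a; have [tb hb] := ktP b.
  have [ja /andP[ja1 ja2]] := jP _ ta; have [jb /andP[jb1 jb2]] := jP _ tb.
  rewrite /= !inordK // => jab.
  have tab : `|(kt a).2 - (kt b).2| <= 2 / N%:R.
    have lt1 : `|((kt a).2 - (kt b).2) * N%:R / 2| <= 1.
      rewrite [X in `|X|](_ : _ = ((kt a).2 + 1) * N%:R / 2 - ((kt b).2 + 1) * N%:R /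
          2); last by field.
      rewrite jab in ja1 ja2; move: ja1 ja2 jb1 jb2.
      rewrite -[(j (kt b).2).+1%:R]natr1.
      move: (_ / 2) (_ / 2) (_%:R) => u v J ja1 ja2 jb1 jb2.
      by rewrite ler_norml; lra.
    rewrite ler_pdivlMr //; move: lt1.
    by rewrite !normrM normfV !(gtr0_norm N0) (gtr0_norm (ltr0n R 2)) ler_pdivrMr //
        mul1r.
  have sab : `|s a - s b| < tau / M%:R.
    rewrite -ha -hb gk; apply: le_lt_trans (hC _ _ _) _.
    apply: (@le_lt_trans _ _ (C * (2 / N%:R))); first by rewrite ler_wpM2l.
    rewrite /N /M !natrM.
    rewrite -(ltr_pM2r (_ : 0 < 4 * (K%:R * K%:R))); last by rewrite !mulr_gt0.
    rewrite [ltLHS](_ : _ = 8 * C); last by field; rewrite gt_eqF.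
    by rewrite [ltRHS](_ : _ = tau * K%:R) //; field; rewrite gt_eqF.
  have coord (i i' : 'I_M) : `|tau * i%:R / M%:R - tau * i'%:R / M%:R| < tau / M%:R
      -> i = i'.
    rewrite -mulrBl -mulrBr normrM normrM normfV (gtr0_norm M0) (gtr0_norm tau0).
    rewrite ltr_pM2r ?invr_gt0 // -[ltRHS]mulr1 ltr_pM2l // => lt1.
    apply/eqP; rewrite -val_eqE /= eqn_leq -ltnS -[(i' <= i)%N]ltnS -!(ltr_nat R).
    rewrite -[i'.+1%:R]natr1 -[i.+1%:R]natr1; move: lt1; rewrite ltr_norml.
    by move: (i%:R) (i'%:R) => u v /andP[? ?]; apply/andP; split; lra.
  move: sab; rewrite plane_norm_lt => /andP[/coord s1 /coord s2].
  by rewrite [a]surjective_pairing [b]surjective_pairing s1 s2.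
have := leq_card g g_inj.
rewrite !card_prod !card_bool !card_ord /M /N.
have : (0 < K)%N by [].
by move: (K) => k; clear; nia.
Qed.

Lemma square_boundary_curve (k : bool * bool) (t t' : R) :
  let side (k : bool * bool) t : R * R :=
      if k.1 then ((-1) ^+ k.2, t) else (t, (-1) ^+ k.2) in
  `|side k t - side k t'| = `|t - t'|.
Proof.
by case: k => [[] b] /=; rewrite plane_normE /= subrr normr0;
    [rewrite max_r|rewrite max_l].
Qed.

Lemma unit_norm_side (y : R * R) : `|y| = 1 -> exists (k : bool * bool) (t : R),
  -1 <= t <= 1 /\ y = if k.1 then ((-1) ^+ k.2, t) else (t, (-1) ^+ k.2).
Proof.
have sgn (u : R) : `|u| = 1 -> exists b : bool, u = (-1) ^+ b.
  have [u0|u0] := lerP 0 u => u1.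
    by exists false; rewrite expr0 -u1 ger0_norm.
  by exists true; rewrite expr1 -u1 ltr0_norm // opprK.
case: y => y1 y2; rewrite plane_normE /= /Num.max; case: ifP => [lt n2|/negbT];
    last first.
  rewrite -leNgt => le n1; have [b y1E] := sgn _ n1.
  by exists (true, b), y2; split; [rewrite -ler_norml -n1|rewrite /= -y1E].
have [b y2E] := sgn _ n2.
by exists (false, b), y1; split; [rewrite -ler_norml -n2 ltW|rewrite /= -y2E].
Qed.

(** If points [c] arbitrarily near [f 0] are missed by [f], push the image of
    [f] away from [c], radially onto a small square around [c], and apply to it a
    Lipschitz map [H] that nearly inverts [f].  The small square is mapped to
    Lipschitz curves, so that a small shift of [H] has no zero there, nor
    elsewhere.  Since [H \o f] is close to the identity on the boundary, this
    contradicts the existence of a zero. *)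
Theorem invariance_of_domain f : continuous f -> {in square R &, injective f} ->
  exists2 e : R, 0 < e & forall c, `|c - f (0, 0)| < e ->
    exists2 x, square R x & f x = c.
Proof.
move=> cf inj; apply: contrapT => no.
set y0 := f (0, 0).
have sq0 : square R (0, 0) by apply/square_norm; rewrite plane_norm_le /= normr0 ler01.
have half0 : 0 < 2^-1 :> R by rewrite invr_gt0.
have [L1 L10 L1P] := inverse_modulus f 2^-1 cf inj half0.
(* On the boundary, [1 - 2^-1 <= L1 * |f x - y0|], that is,
   [3 * eps <= |f x - y0|]; so a point within [eps] of a point [c] which is
   itself within [eps] of [y0] is not the image of a boundary point. *)
pose eps : R := (6 * L1)^-1.
have eps0 : 0 < eps by rewrite invr_gt0 mulr_gt0.
have bdry x : square R x -> `|x| = 1 -> 3 * eps <= `|f x - y0|.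
  move=> xs x1; have := L1P x (0, 0) xs sq0.
  have -> : x - (0, 0) = x by case: (x) => a b; congr pair; rewrite /= subr0.
  rewrite x1 -/y0 => h.
  have -> : 3 * eps = 2^-1 / L1 by rewrite /eps; field; rewrite gt_eqF.
  by rewrite ler_pdivrMr // [leRHS]mulrC; lra.
have [c cy0 cN] : exists2 c, `|c - y0| < eps & forall x, square R x -> f x <> c.
  apply: contrapT => noc; apply: no; exists eps => // c cy; apply: contrapT => nox.
  by apply: noc; exists c => // x xs fx; apply: nox; exists x.
have [tau tau0 tauP] : exists2 tau : R, 0 < tau & forall x, `|x| < tau ->
    `|f x - c| < eps.
  have d0 : 0 < eps - `|c - y0| by rewrite subr_gt0.
  have /cvgrPdist_lt/(_ _ d0)/nbhs_ballP[tau /= tau0 tb] := cf (0, 0).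
  exists tau => // x xt; have : `|y0 - f x| < eps - `|c - y0|.
    apply: tb; rewrite -ball_normE /=.
    have -> : (0, 0) - x = - x by case: (x) => a b; congr pair; rewrite /= sub0r.
    by rewrite normrN.
  rewrite distrC [`|c - y0|]distrC => h.
  by apply: le_lt_trans (ler_distD y0 _ _) _; lra.
pose tau' := Num.min tau 1.
have tau'0 : 0 < tau' by rewrite lt_min tau0 /=.
have tau'1 : tau' <= 1 by rewrite ge_min lexx orbT.
have tau'P x : `|x| < tau' -> `|f x - c| < eps.
  by move=> xt; apply: tauP; apply: lt_le_trans xt _; rewrite ge_min lexx.
(* Where the push is the identity, [x] has norm at least [4 * delta], whereas
   [H] and the shift [s] contribute errors of at most [delta] each. *)
pose delta := tau' / 4.
have delta0 : 0 < delta by rewrite divr_gt0.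
have [L L0 LP] := inverse_modulus f delta cf inj delta0.
have [H1 [H1L H1P]] : exists H : R * R ->
    R, (forall y y', `|H y - H y'| <= L * `|y - y'|) /\
    forall x, square R x -> x.1 - delta <= H (f x) <= x.1.
  apply: lipschitz_extension; first exact: ltW.
    by move=> x /square_norm; apply: le_trans; exact: fst_norm_le.
  move=> x x' xs x's; apply: le_trans (LP x x' xs x's); rewrite lerD2r.
  by apply: le_trans (ler_norm _) _; exact: (fst_norm_le (x - x')).
have [H2 [H2L H2P]] : exists H : R * R ->
    R, (forall y y', `|H y - H y'| <= L * `|y - y'|) /\
    forall x, square R x -> x.2 - delta <= H (f x) <= x.2.
  apply: lipschitz_extension; first exact: ltW.
    by move=> x /square_norm; apply: le_trans; exact: snd_norm_le.
  move=> x x' xs x's; apply: le_trans (LP x x' xs x's); rewrite lerD2r.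
  by apply: le_trans (ler_norm _) _; exact: (snd_norm_le (x - x')).
pose side (k : bool * bool) (t : R) : R * R :=
  if k.1 then ((-1) ^+ k.2, t) else (t, (-1) ^+ k.2).
pose h k t : R * R := (- H1 (c + eps *: side k t), - H2 (c + eps *: side k t)).
have [s s_lt sP] : exists2 s : R * R, `|s| < delta & forall k t, -1 <= t <= 1 ->
    h k t <> s.
  apply: (lipschitz_curves_avoid h (L * eps)) => //; first by rewrite mulr_ge0 // ltW.
  move=> k t t'.
  have dist : `|(c + eps *: side k t') - (c + eps *: side k t)| = eps * `|t - t'|.
    rewrite opprD addrACA subrr add0r -scalerBr normrZ gtr0_norm //
        square_boundary_curve.
    by rewrite distrC.
  rewrite plane_norm_le /= !opprK ![- H1 _ + _]addrC ![- H2 _ + _]addrC -mulrA -dist.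
  by rewrite H1L H2L.
pose push y := c + (Num.max eps `|y - c| / `|y - c|) *: (y - c).
have push_far y : eps <= `|y - c| -> push y = y.
  move=> far; rewrite /push max_r // divff ?scale1r; first by rewrite addrC subrK.
  by rewrite gt_eqF // (lt_le_trans eps0).
have push_near y : y <> c -> `|y - c| < eps ->
    exists k t, -1 <= t <= 1 /\ push y = c + eps *: side k t.
  move=> yc near; have n0 : 0 < `|y - c| by rewrite normr_gt0 subr_eq0; apply/eqP.
  have [|k [t [t1 E]]] := unit_norm_side (`|y - c|^-1 *: (y - c)).
    by rewrite normrZ gtr0_norm ?invr_gt0 // mulVf // gt_eqF.
  exists k, t; split=> //; rewrite /side -E /push max_l ?ltW //.
  by rewrite scalerA.
have push_cont y : y <> c -> {for y, continuous push}.
  move=> yc; have n0 : `|y - c| != 0 by rewrite normr_eq0 subr_eq0; apply/eqP.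
  have cd : (z - c) @[z --> y] --> y - c by apply: cvgB; [exact: cvg_id|exact: cvg_cst].
  have cn : `|z - c| @[z --> y] --> `|y - c| by exact: cvg_norm.
  apply: cvgD; first exact: cvg_cst.
  apply: cvgZ => //; apply: cvgM; last exact: cvgV.
  apply: (@continuous_max R (R * R)%type (fun=> eps) (fun z => `|z - c|)) => //.
  exact: cvg_cst.
pose g (H : R * R -> R) (s : R) x := H (push (f (clamp x))) + s.
have H_cont H : (forall y y', `|H y - H y'| <= L * `|y - y'|) -> continuous H.
  move=> HL y; apply/cvgrPdist_lt => e e0.
  have near_y : nbhs y (ball y (e / L)) by apply: nbhsx_ballx; rewrite divr_gt0.
  apply: (filterS _ near_y).
  move=> z; rewrite -ball_normE /= => yz.
  apply: le_lt_trans (HL _ _) _.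
  by move: yz; rewrite ltr_pdivlMr // mulrC.
have g_cont H s' : (forall y y', `|H y - H y'| <= L * `|y - y'|) -> continuous (g H s').
  move=> HL x; apply: cvgD; last exact: cvg_cst.
  apply: (@continuous_comp _ _ _ (fun x => push (f (clamp x))) H); last exact: H_cont.
  apply: (@continuous_comp _ _ _ (fun x => f (clamp x)) push).
    by apply: (@continuous_comp _ _ _ clamp f); [exact: clamp_continuous|exact: cf].
  by apply: push_cont; apply: cN; exact: clamp_square.
have clampE x : square R x -> clamp x = x := clamp_id x.
have far x : square R x -> `|x| = 1 -> push (f x) = f x.
  move=> xs x1; apply: push_far; have := bdry x xs x1.
  have := ler_distD c (f x) y0; lra.
have [s1 s2] : `|s.1| < delta /\ `|s.2| < delta by apply/andP; rewrite -plane_norm_lt.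
have [|x xs [g1 g2]] := poincare_miranda R _ _ (g_cont H1 s.1 H1L) (g_cont H2 s.2 H2L).
  move=> t t1.
  have e1 : `|1 : R| = 1 by rewrite normr1.
  have eN1 : `|-1 : R| = 1 by rewrite normrN normr1.
  have tn : `|t| <= 1 by rewrite ler_norml.
  have bd x : `|x| = 1 -> square R x by move=> x1; apply/square_norm; rewrite x1.
  have n1 : `|(-1, t) : R * R| = 1 by rewrite plane_normE /= eN1 max_l.
  have n2 : `|(1, t) : R * R| = 1 by rewrite plane_normE /= e1 max_l.
  have n3 : `|(t, -1) : R * R| = 1 by rewrite plane_normE /= eN1 max_r.
  have n4 : `|(t, 1) : R * R| = 1 by rewrite plane_normE /= e1 max_r.
  rewrite /g !clampE; try exact: bd.
  rewrite !far; try by [|exact: bd].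
  have := H1P _ (bd _ n1); have := H1P _ (bd _ n2).
  have := H2P _ (bd _ n3); have := H2P _ (bd _ n4) => /=.
  move: s1 s2; rewrite !ltr_norml /delta =>
      /andP[? ?] /andP[? ?] /andP[? ?] /andP[? ?] /andP[? ?] /andP[? ?].
  by split; lra.
move: g1 g2; rewrite /g !clampE // => g1 g2.
have [fc|fc] := ltP `|f x - c| eps.
  have [k [t [t1 pE]]] := push_near _ (cN x xs) fc.
  apply: (sP k t t1); rewrite /h -pE; apply/eqP; rewrite -pair_eqE; apply/andP.
  by split; apply/eqP => /=; apply/esym/eqP; rewrite -addr_eq0 addrC; apply/eqP.
have : tau' <= `|x| by rewrite leNgt; apply/negP => /tau'P; rewrite ltNge fc.
rewrite push_far // in g1 g2; have := H1P x xs; have := H2P x xs.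
move: s1 s2; rewrite plane_normE le_max !ltr_norml /delta =>
    /andP[? ?] /andP[? ?] /andP[? ?] /andP[? ?].
have small (u : R) : u <= tau' / 2 -> - (tau' / 2) <= u -> tau' <= `|u| -> False.
  move=> u1 u2; apply/negP; rewrite -ltNge; apply: (@le_lt_trans _ _ (tau' / 2));
      last lra.
  by rewrite ler_norml u1 u2.
by move=> /orP[] /small; apply; lra.
Qed.

End InvarianceOfDomain.

(** * Charts of a triangulated surface *)

Section Charts.
Context (R : realType).

Lemma continuous_into_subtype (X Y : topologicalType) (A : set Y) (h : X ->
    set_type A) :
  continuous (fun x => set_val (h x)) -> continuous h.
Proof. by move=> ch; apply: (@continuous_comp_initial (set_type A) X Y set_val h). Qed.

Lemma continuous_set_val (Y : topologicalType) (A : set Y) :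
  continuous (set_val : set_type A -> Y).
Proof. exact: initial_continuous. Qed.

Lemma continuous_into_prod (X : topologicalType) (V : eqType) (h : X -> V -> R) :
  (forall v, continuous (fun x => h x v)) ->
  continuous (h : X -> prod_topology (fun _ : V => R)).
Proof.
move=> ch x; apply/cvg_sup => v.
exact: (@continuous_comp_initial _ X R (fun r : V -> R => r v) h (ch v) x).
Qed.

Lemma continuous_coordinate (X : topologicalType) (V : eqType) (h : X ->
    prod_topology (fun _ : V => R)) v :
  continuous h -> continuous (fun x => h x v).
Proof.
move=> ch x; apply: (@continuous_comp _ _ _ h (fun r : prod_topology (fun _ : V =>
    R) => r v) x).
  exact: ch.
exact: (@proj_continuous V (fun=> R) v (h x)).
Qed.

Lemma continuous_pair_plane (X : topologicalType) (h : X -> R * R) :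
  continuous (fun x => (h x).1) -> continuous (fun x => (h x).2) -> continuous h.
Proof. by move=> c1 c2 x; apply: cvg_plane; [exact: c1|exact: c2]. Qed.

(** A chart of [K] centred at [x].  All maps are total: [psi] is a parametrization
    by the square, composed with a retraction of the plane onto the square, and
    [phi] inverts it near [x].  Since [phi] is meaningful on [K] only, its
    continuity is expressed along maps from the plane to [K]. *)
Definition chart_at (V : finType) (K : set (prod_topology (fun _ : V => R)))
    (x : prod_topology (fun _ : V => R)) : Prop :=
  exists (phi : (V -> R) -> R * R) (psi : R * R -> prod_topology (fun _ : V => R))
    (N : set (prod_topology (fun _ : V => R))),
  [/\ nbhs x N, continuous psi, psi (0, 0) = x & forall q, K (psi q)] /\
  [/\ forall q, square R q -> phi (psi q) = q,
      forall y, N y -> K y -> psi (phi y) = y,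
      forall e : R, 0 < e -> \forall y \near x, K y -> `|phi y| < e &
      forall h : R * R -> prod_topology (fun _ : V => R), continuous h ->
        (forall q, N (h q) /\ K (h q)) -> continuous (fun q => phi (h q))].

(** Rescale and translate a local homeomorphism to the plane so that its image
    contains the square. *)
Lemma surface_chart (M : topologicalType) (V : finType)
    (K : set (prod_topology (fun _ : V => R))) :
  locally_euclidean2 R M -> homeomorphic (set_type K : topologicalType) M ->
  forall x, K x -> chart_at V K x.
Proof.
move=> locM [f [g [fK gK cf cg]]] x Kx.
pose inK y (Ky : K y) : set_type K := exist _ y (mem_set Ky).
pose p := f (inK x Kx).
have [U [W [oU Up oW [a [b [aK bK ca cb]]]]]] := locM p.
pose inU y (Uy : U y) : set_type U := exist _ y (mem_set Uy).
pose w0 : 'rV[R]_2 := set_val (a (inU p Up)).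
have [e e0 eW] : exists2 e : R, 0 < e & ball w0 e `<=` W.
  have Ww0 : W w0 by exact: set_valP.
  have /nbhs_ballP[e /= e0 eW] : nbhs w0 W by apply: open_nbhs_nbhs.
  by exists e.
pose d (i : 'I_2) : 'rV[R]_2 := delta_mx 0 i.
pose C : R := `|d 0| + `|d 1|.
pose rho : R := e / (C + 1) / 2.
have C0 : 0 <= C by rewrite addr_ge0.
have rho0 : 0 < rho by rewrite !divr_gt0 // ltr_wpDl.
pose toW (q : R * R) : 'rV[R]_2 := w0 + rho *: (q.1 *: d 0 + q.2 *: d 1).
have toWP q : W (toW (clamp R q)).
  apply: eW; rewrite -ball_normE /= /toW opprD addNKr normrN normrZ gtr0_norm //.
  have /square_norm := clamp_square R q; rewrite plane_norm_le => /andP[q1 q2].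
  apply: (@le_lt_trans _ _ (rho * C)).
    rewrite ler_pM2l //; apply: le_trans (ler_normD _ _) _.
    by rewrite !normrZ lerD // ler_piMl.
  rewrite /rho mulrAC ltr_pdivrMr // mulrAC ltr_pdivrMr; last by rewrite ltr_wpDl.
  nra.
pose inW (q : R * R) : set_type W := exist _ (toW (clamp R q)) (mem_set (toWP q)).
pose psi q : prod_topology (fun _ : V => R) := set_val (g (set_val (b (inW q)))).
have toW_cont : continuous toW.
  move=> q; apply: cvgD; first exact: cvg_cst.
  apply: cvgZr; apply: cvgD; apply: cvgZl; [exact: cvg_fst|exact: cvg_snd].
have inW_cont : continuous inW.
  apply: continuous_into_subtype => q.
  by apply: (@continuous_comp _ _ _ (clamp R) toW);
      [exact: clamp_continuous|exact: toW_cont].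
have psi_cont : continuous psi.
  move=> q; apply: (@continuous_comp _ _ _ (fun q =>
      g (set_val (b (inW q)))) set_val); last exact: continuous_set_val.
  apply: (@continuous_comp _ _ _ (fun q => set_val (b (inW q))) g); last exact: cg.
  apply: (@continuous_comp _ _ _ (fun q => b (inW q)) set_val);
      last exact: continuous_set_val.
  by apply: (@continuous_comp _ _ _ inW b); [exact: inW_cont|exact: cb].
pose fromW (w : 'rV[R]_2) : R * R := ((w 0 0 - w0 0 0) / rho, (w 0 1 - w0 0 1) / rho).
have fromW_cont : continuous fromW.
  have coord i : continuous (fun w : 'rV[R]_2 => (w 0 i - w0 0 i) / rho).
    move=> w; apply: (@continuous_comp _ _ _ (fun w : 'rV[R]_2 =>
        w 0 i) (fun t : R => (t - w0 0 i) / rho)).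
      exact: coord_continuous.
    move: (w 0 i) => t; apply: (@cvgM R R (nbhs t) _ (fun t =>
        t - w0 0 i) (fun=> rho^-1)); last exact: cvg_cst.
    by apply: cvgB; [exact: cvg_id|exact: cvg_cst].
  by apply: continuous_pair_plane; exact: coord.
have fromW_toW q : fromW (toW q) = q.
  rewrite /fromW /toW !mxE /=.
  case: q => q1 q2 /=; congr pair; field; rewrite gt_eqF //.
have toW_fromW w : toW (fromW w) = w.
  apply/rowP => i; rewrite !mxE /=.
  have [->|->] : i = 0 \/ i = 1 by case: i => [[|[|]]] // ?; [left|right];
      apply: val_inj.
    by rewrite /=; field; rewrite gt_eqF.
  by rewrite /=; field; rewrite gt_eqF.
pose phi (y : V -> R) : R * R :=
  if pselect (K y) is left Ky then
    if pselect (U (f (inK y Ky))) is left Uy then fromW (set_val (a (inU _ Uy))) else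
        (0, 0)
  else (0, 0).
have phiE y (Ky : K y) (Uy : U (f (inK y Ky))) : phi y = fromW (set_val (a (inU _ Uy))).
  rewrite /phi; case: pselect => // Ky'; rewrite (Prop_irrelevance Ky' Ky).
  by case: pselect => // Uy'; rewrite (Prop_irrelevance Uy' Uy).
have near_x (e' : R) : 0 < e' ->
    exists O : set (prod_topology (fun _ : V => R)), [/\ open O, O x &
      forall y (Ky : K y), O y ->
      exists Uy : U (f (inK y Ky)), `|fromW (set_val (a (inU _ Uy)))| < e'].
  move=> e'0.
  have near_u : nbhs (inU p Up) [set u | `|fromW (set_val (a u))| < e'].
    have /(_ (inU p Up)) c : continuous (fun u => fromW (set_val (a u))).
      move=> u; apply: (@continuous_comp _ _ _ (fun u => set_val (a u)) fromW);
          last exact: fromW_cont.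
      by apply: (@continuous_comp _ _ _ a set_val);
          [exact: ca|exact: continuous_set_val].
    apply: (c [set q : R * R | `|q| < e']) => /=; rewrite -/w0.
    have -> : fromW w0 = (0, 0) by rewrite /fromW !subrr !mul0r.
    have := @nbhsx_ballx R (R * R)%type (0, 0) e' e'0; apply: filterS => q.
    rewrite -ball_normE /=.
    by have -> : (0, 0) - q = - q by [case: q => ? ?; congr pair; rewrite /= sub0r];
        rewrite normrN.
  have [_ [[B oB <-] Bp BS]] := near_u.
  have near_p : nbhs p (U `&` B) by apply: open_nbhs_nbhs; split; [exact: openI|split].
  have near_k : nbhs (inK x Kx) (f @^-1` (U `&` B)) := cf (inK x Kx) _ near_p.
  have [_ [[Q oQ <-] Qx QS]] := near_k.
  exists Q; split=> // y Ky Qy; have [Uy By] := QS (inK y Ky) Qy.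
  by exists Uy; apply: BS.
have [N [oN Nx NP]] := near_x 1 ltr01.
have psiK q : K (psi q) by exact: set_valP.
have fpsi q (Kq : K (psi q)) : f (inK (psi q) Kq) = set_val (b (inW q)).
  have -> : inK (psi q) Kq = g (set_val (b (inW q))) by apply: val_inj.
  by rewrite gK.
exists phi, psi, N; split; [split=> //|split=> //].
- exact: open_nbhs_nbhs.
- rewrite /psi; have -> : inW (0, 0) = a (inU p Up).
    apply: val_inj => /=; rewrite clamp_id; last first.
      by apply/square_norm; rewrite plane_norm_le /= normr0 ler01.
    by rewrite /toW /= !scale0r addr0 scaler0 addr0.
  by rewrite aK /= /p fK.
- move=> q qs; have Uq : U (f (inK (psi q) (psiK q))) by rewrite fpsi; exact: set_valP.
  rewrite (phiE _ _ Uq); have -> : inU _ Uq = b (inW q) by apply: val_inj;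
      rewrite /= fpsi.
  by rewrite bK -[set_val (inW q)]/(toW (clamp R q)) clamp_id // fromW_toW.
- move=> y Ny Ky; have [Uy /ltW/square_norm sq] := NP y Ky Ny; rewrite (phiE _ _ Uy).
  rewrite /psi; have -> : inW (fromW (set_val (a (inU _ Uy)))) = a (inU _ Uy).
    by apply: val_inj; rewrite /= clamp_id // toW_fromW.
  by rewrite aK /= fK.
- move=> e' e'0; have [Q [oQ Qx QP]] := near_x e' e'0.
  have near_Q : nbhs x Q by apply: open_nbhs_nbhs.
  apply: filterS near_Q => y Qy Ky.
  by have [Uy lt] := QP y Ky Qy; rewrite (phiE _ _ Uy).
- move=> h ch hP.
  have hU q : U (f (inK (h q) (hP q).2)) by have [Uq _] := NP _ (hP q).2 (hP q).1.
  have -> : (fun q => phi (h q)) = (fun q => fromW (set_val (a (inU _ (hU q))))).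
    by apply/funext => q; exact: phiE.
  move=> q; apply: (@continuous_comp _ _ _ (fun q =>
      set_val (a (inU _ (hU q)))) fromW); last exact: fromW_cont.
  apply: (@continuous_comp _ _ _ (fun q => a (inU _ (hU q))) set_val);
      last exact: continuous_set_val.
  apply: (@continuous_comp _ _ _ (fun q => inU _ (hU q)) a); last exact: ca.
  apply: continuous_into_subtype => {}q.
  apply: (@continuous_comp _ _ _ (fun q => inK (h q) (hP q).2) f); last exact: cf.
  by apply: continuous_into_subtype => {}q; exact: ch.
Qed.

End Charts.

Section LocalStructure.
Context (R : realType) (V : finType) (F : {set {set V}}).
Notation points := (prod_topology (fun _ : V => R)).
Local Notation K := (@realization R V F).

(** The point of the realization at the vertex [a]. *)
Definition vertex (a w : V) : R := (w == a)%:R.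

Lemma sum_vertex a : \sum_w vertex a w = 1.
Proof.
rewrite (bigD1 a) //= /vertex eqxx big1 ?addr0 // => w /negbTE->//.
Qed.

Lemma vertex_combination (f : {set V}) (a b c : V) (al be ga : R) :
  f \in F -> a \in f -> b \in f -> c \in f -> 0 <= al -> 0 <= be -> 0 <= ga ->
  al + be + ga = 1 -> K (fun w => al * vertex a w + be * vertex b w + ga * vertex c w).
Proof.
move=> fF af bf cf al0 be0 ga0 sum1; split.
- by move=> w; rewrite !addr_ge0 // mulr_ge0 // /vertex ler0n.
- by rewrite !big_split /= -!mulr_sumr !sum_vertex !mulr1.
- exists f => // w wf; rewrite /vertex.
  have ne x : x \in f -> (w == x) = false by move=> xf; apply: contraNF wf => /eqP ->.
  by rewrite !ne // !mulr0 !addr0.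
Qed.

Lemma vertex_in_realization (f : {set V}) (a : V) : f \in F -> a \in f -> K (vertex a).
Proof.
move=> fF af; have := vertex_combination f a a a 1 0 0 fF af af af ler01 (lexx 0)
    (lexx 0).
rewrite !addr0 => /(_ erefl); congr (@realization R V F _).
by apply/funext => w; rewrite mul1r !mul0r !addr0.
Qed.

Lemma realization_support (y : points) : K y ->
  exists2 f, f \in F & forall w, y w != 0 -> w \in f.
Proof.
move=> [_ _ [f fF yf]]; exists f => // w; apply: contraNT => /yf ->.
exact: eqxx.
Qed.

Lemma sum_support (y : points) (A : {set V}) :
  K y -> (forall w, w \notin A -> y w = 0) -> \sum_(w in A) y w = 1.
Proof.
move=> [_ <- _] yA; rewrite [RHS](bigID (mem A)) /= [X in _ + X]big1 ?addr0 //.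
Qed.

(** Otherwise the function adding up the barycentric coordinates in [I] would
    take the values [0] and [1], and no other. *)
Lemma vertices_connected_of_surface (M : topologicalType) (I : {set V}) :
  homeomorphic (set_type K : topologicalType) M -> connected [set: M] ->
  (forall v : V, exists2 f : {set V}, f \in F & v \in f) ->
  I != finset.set0 -> I \proper [set: V]%SET ->
  exists f x y, [/\ f \in F, x \in f, y \in f, x \in I & y \notin I].
Proof.
move=> [h [g [hK gK ch cg]]] conM cov /set0Pn[a aI] /fintype.properP[_ [b _ bI]].
apply: contrapT => no.
pose s (y : points) : R := \sum_(v in I) y v.
have s_cont : continuous (fun m : M => s (set_val (g m))).
  apply: continuous_big => [|v _]; first exact: add_continuous.
  apply: (continuous_coordinate R M V (fun m => set_val (g m)) v) => m.
  by apply: (@continuous_comp _ _ _ g set_val); [exact: cg|exact: continuous_set_val].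
have con : connected [set s (set_val (g m)) | m in [set: M]].
  apply: connected_continuous_connected => //.
  exact: continuous_subspaceT.
have in_image (y : points) : K y -> [set s (set_val (g m)) | m in [set: M]] (s y).
  move=> Ky; exists (h (exist _ y (mem_set Ky) : set_type K)) => //.
  by rewrite hK.
have [fa faF afa] := cov a; have [fb fbF bfb] := cov b.
have sa : s (vertex a) = 1.
  rewrite /s (bigD1 a) //= /vertex eqxx big1 ?addr0 // => w /andP[_ /negbTE->].
  by [].
have sb : s (vertex b) = 0.
  rewrite /s big1 // => w wI; rewrite /vertex.
  by case: eqP wI bI => // -> ->.
have : [set s (set_val (g m)) | m in [set: M]] 2^-1.
  apply: (connected_intervalP _).1 con 0 1 _ _ _ _.
  - by rewrite -sb; apply: in_image; apply: vertex_in_realization fbF bfb.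
  - by rewrite -sa; apply: in_image; apply: vertex_in_realization faF afa.
  - by apply/andP; split; lra.
move=> [m _ sm]; set y := set_val (g m) in sm.
have Ky : K y by exact: set_valP.
have [f fF yf] := realization_support y Ky.
have [fI|] := boolP (f \subset I).
  move: sm; rewrite /s sum_support //; first by lra.
  by move=> w; apply: contraNeq => /yf; exact: fintype.subsetP.
move=> /subsetPn[y0 y0f y0I].
move: sm; rewrite /s big1; first by lra.
move=> w wI; apply: contrapT => /eqP/yf wf; apply: no.
by exists f, w, y0.
Qed.

Hypothesis triangle3 : forall f, f \in F -> #|f| = 3%N.
Hypothesis charts : forall x : points, K x -> chart_at R V K x.

(** Intermediate values along the segment from [p] to [q] or, if it passes through
    the centre, along the segment from a third point to [p] or to [q]. *)
Lemma punctured_sign (sigma : R * R -> R) (e : R) (p q : R * R) :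
  continuous sigma -> (forall x, 0 < `|x| -> `|x| < e -> sigma x != 0) ->
  0 < `|p| < e -> 0 < `|q| < e -> sigma p < 0 -> 0 < sigma q -> False.
Proof.
move=> cs nz.
have segment (u v : R * R) : `|u| < e -> `|v| < e -> sigma u < 0 -> 0 < sigma v ->
    exists2 t : R, 0 < t < 1 & (1 - t) *: u + t *: v = 0.
  move=> ue ve su sv.
  pose l (t : R) : R * R := (1 - t) *: u + t *: v.
  have l_cont : continuous l.
    move=> t; apply: cvgD; apply: cvgZr_tmp.
      by apply: cvgB; [exact: cvg_cst|exact: cvg_id].
    exact: cvg_id.
  have sl_cont : continuous (fun t => sigma (l t)).
    by move=> t; apply: (@continuous_comp _ _ _ l sigma); [exact: l_cont|exact: cs].
  have l0 : l 0 = u by rewrite /l subr0 scale1r scale0r addr0.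
  have l1 : l 1 = v by rewrite /l subrr scale1r scale0r add0r.
  have [||t] := @IVT R (fun t => sigma (l t)) 0 1 0 ler01.
  - exact: continuous_subspaceT.
  - by rewrite l0 l1 ge_min (ltW su) le_max (ltW sv) orbT.
  rewrite in_itv /= => /andP[t0 t1] st.
  have lt_e : `|l t| < e.
    apply: le_lt_trans (ler_normD _ _) _;
        rewrite !normrZ ger0_norm ?subr_ge0 // ger0_norm //.
    pose m := Num.max `|u| `|v|; have me : m < e by rewrite gt_max ue.
    have h1 : (1 - t) * `|u| <= (1 - t) * m by rewrite ler_wpM2l ?subr_ge0 // le_max
        lexx.
    have h2 : t * `|v| <= t * m by rewrite ler_wpM2l // le_max lexx orbT.
    apply: le_lt_trans (lerD h1 h2) _; rewrite -mulrDl subrK mul1r //.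
  exists t.
    rewrite !lt_neqAle t0 t1 !andbT; apply/andP; split; apply/eqP => tE; move: st.
      by rewrite -tE l0 => su0; rewrite su0 ltxx in su.
    by rewrite tE l1 => sv0; rewrite sv0 ltxx in sv.
  apply/eqP; apply: contraT => l_neq0; have := nz (l t) _ lt_e;
      rewrite normr_gt0 => /(_ l_neq0).
  by rewrite st eqxx.
move=> /andP[p0 pe] /andP[q0 qe] sp sq.
have [t /andP[t0 t1] pq] := segment p q pe qe sp sq.
(* A third point off the line through [p] and [q]. *)
pose r : R * R := (- p.2, p.1).
have r_norm : `|r| = `|p| by rewrite !plane_normE /= normrN maxC.
have collinear (k : R) : k *: p + r = 0 -> False.
  move=> /pair_equal_spec[/= h1 h2]; move: p0; rewrite normr_gt0; apply/negP;
      rewrite negbK.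
  have {}h1 : p.2 = k * p.1 by apply/eqP; rewrite eq_sym -subr_eq0; apply/eqP.
  have {}h2 : k * p.2 + p.1 = 0 by [].
  have p1 : p.1 = 0.
    have : (k ^+ 2 + 1) * p.1 = 0 by rewrite -h2 h1; ring.
    move=> /eqP; rewrite mulf_eq0 => /orP[|/eqP//].
    by rewrite gt_eqF // ltr_wpDl // sqr_ge0.
  have p2 : p.2 = 0 by rewrite h1 p1 mulr0.
  by rewrite [p]surjective_pairing p1 p2.
have qE : q = - ((1 - t) / t) *: p.
  have : t *: q = - ((1 - t) *: p) by apply/eqP; rewrite -addr_eq0 addrC pq.
  move=> /(congr1 ( *:%R t^-1)); rewrite scalerA mulVf ?gt_eqF // scale1r => ->.
  by rewrite scalerN scalerA scaleNr mulrC.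
have shift (x y : R) : x != 0 -> y *: p + x *: r = 0 -> (x^-1 * y) *: p + r = 0.
  by move=> x0 h; rewrite -[RHS](scaler0 _ x^-1) -h scalerDr !scalerA mulVf // scale1r.
have : sigma r != 0 by apply: nz; rewrite r_norm.
rewrite neq_lt => /orP[sr|sr].
  have [k /andP[k0 k1]] := segment r q ltac:(by rewrite r_norm) qe sr sq.
  rewrite qE scalerA addrC => h; apply: (collinear ((1 - k)^-1 * (k * - ((1 - t) /
      t)))).
  by apply: shift h; rewrite subr_eq0 gt_eqF.
have [k /andP[k0 k1]] := segment p r pe ltac:(by rewrite r_norm) sp sr.
move=> h; apply: (collinear (k^-1 * (1 - k))).
by apply: shift h; rewrite gt_eqF.
Qed.

Lemma near_curve (gam : R -> points) (P : set points) :
  continuous gam -> nbhs (gam 0) P -> exists2 t, 0 < t < 1 & P (gam t).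
Proof.
move=> cg nP; have near0 : nbhs (0 : R) (gam @^-1` P) := cg 0 _ nP.
have [e /= e0 eP] := (nbhs_ballP _ _).1 near0.
exists (Num.min e 1 / 2).
  have m0 : 0 < Num.min e 1 by rewrite lt_min e0 /=.
  have : Num.min e 1 <= 1 by rewrite ge_min lexx orbT.
  by move=> ?; apply/andP; split; lra.
have m0 : 0 < Num.min e 1 by rewrite lt_min e0 /=.
have : Num.min e 1 <= e by rewrite ge_min lexx.
by move=> ?; apply: eP; rewrite /ball /= sub0r normrN gtr0_norm; lra.
Qed.

Lemma segment_continuous (a b c : V) (al be ga : R -> R) :
  continuous al -> continuous be -> continuous ga ->
  continuous ((fun t w => al t * vertex a w + be t * vertex b w + ga t * vertex c w)
      : R -> points).
Proof.
move=> cal cbe cga; apply: continuous_into_prod => w t.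
by apply: cvgD; [apply: cvgD|]; apply: cvgM; try exact: cvg_cst;
    [exact: cal|exact: cbe|exact: cga].
Qed.

Lemma realization_vertex (y : points) v : K y -> y v = 1 -> y = vertex v.
Proof.
move=> [y0 ysum _] yv; apply/funext => w; rewrite /vertex; have [->//|wv] := eqVneq w v.
move: ysum; rewrite (bigD1 v) //= yv -[RHS]addr0 => /addrI sum0.
have /psumr_eq0P : forall w, w != v -> 0 <= y w by move=> ? _; apply: y0.
by move=> /(_ sum0 w wv).
Qed.

(** Otherwise the barycentric coordinates of the triangles of [A] around [v],
    minus those of the other triangles around [v], would add up to a function
    that takes both signs near [v] and vanishes only at [v]. *)
Lemma link_connected_of_charts (v : V) (A : {set {set V}}) :
  A \subset F -> (exists2 f, f \in A & v \in f) ->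
  (exists2 g, g \in F :\: A & v \in g) ->
  exists e f g, [/\ e \in edges F, f \in A, g \in F :\: A, e \subset f &
                   e \subset g].
Proof.
move=> AF [f0 f0A vf0] [g0 g0A vg0]; apply: contrapT => no.
have f0F := fintype.subsetP AF _ f0A.
have g0F : g0 \in F by move: g0A; rewrite inE => /andP[].
have share (f g : {set V}) w : f \in A -> g \in F :\: A -> v \in f -> v \in g ->
    w \in f -> w \in g -> w = v.
  move=> fA gA vf vg wf wg; apply/eqP; apply: contraT => wv; exfalso; apply: no.
  exists [set v; w]%SET, f, g; split=> //.
  - by apply: edge_set2 (fintype.subsetP AF _ fA) vf wf _; rewrite eq_sym.
  - by rewrite finset.subUset !finset.sub1set vf.
  - by rewrite finset.subUset !finset.sub1set vg.
pose W (B : {set {set V}}) := [set w | (w != v) && [exists f in B,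
    (v \in f) && (w \in f)]]%SET.
pose s (y : points) : R := \sum_(w in W A) y w - \sum_(w in W (F :\: A)) y w.
have part (B C : {set {set V}}) (y : points) (f : {set V}) : K y ->
    (forall w, y w != 0 -> w \in f) ->
    v \in f -> f \in B ->
    (forall (g : {set V}) w, g \in C -> v \in g -> w \in g -> w \in f -> w = v) ->
    \sum_(w in W B) y w = 1 - y v /\ \sum_(w in W C) y w = 0.
  move=> Ky yf vf fB sep; split; last first.
    apply: big1 => w; rewrite inE => /andP[wv /exists_inP[g gC /andP[vg wg]]].
    apply: contrapT => /eqP/yf wf; have := sep g w gC vg wg wf.
    by move=> wv'; rewrite wv' eqxx in wv.
  rewrite -(sum_support y (v |: W B)%SET Ky).
    by rewrite big_setU1 /=; [rewrite addrAC subrr add0r|rewrite inE eqxx].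
  move=> w wN; apply: contrapT => /eqP/yf wf; move/negP: wN; apply.
  rewrite !inE; case: eqVneq => //= _; apply/exists_inP; exists f => //.
  by rewrite vf.
have sP (y : points) : K y -> 0 < y v -> exists f : {set V}, [/\ f \in F, forall w,
    y w != 0 -> w \in f, v \in f &
    (f \in A /\ s y = 1 - y v) \/ (f \in F :\: A /\ s y = y v - 1)].
  move=> Ky yv; have [f fF yf] := realization_support y Ky.
  have vf : v \in f by apply: yf; rewrite gt_eqF.
  exists f; split=> //; have [fA|fA] := boolP (f \in A); [left|right].
    have [|sA sB] := part A (F :\: A) y f Ky yf vf fA; last by rewrite /s sA sB subr0.
    by move=> g w gA vg wg wf; exact: share fA gA vf vg wf wg.
  have fFA : f \in F :\: A by rewrite inE fA.
  have [|sA sB] := part (F :\: A) A y f Ky yf vf fFA; last by rewrite /s sA sB;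
      split=> //; ring.
  by move=> g w gA vg wg wf; exact: share gA fFA vg vf wg wf.
have [phi [psi [N [[nN psi_cont psi0 psiK] [phipsi psiphi phi_small _]]]]] :=
  charts _ (vertex_in_realization f0 v f0F vf0).
have s_cont : continuous (fun q => s (psi q)).
  move=> q; apply: cvgB.
    apply: (@continuous_big R V +%R 0 (mem (W A)) add_continuous _ (index_enum V)
        (fun w q => psi q w)) => w _.
    exact: continuous_coordinate.
  apply: (@continuous_big R V +%R 0 (mem (W (F :\: A))) add_continuous _ (index_enum
      V) (fun w q => psi q w)) => w _.
  exact: continuous_coordinate.
have [e e0 eP] : exists2 e : R, 0 < e <= 1 & forall q, `|q| < e -> 0 < psi q v.
  have c := continuous_coordinate R _ V psi v psi_cont (0, 0).
  have := cvgr_gt _ c 0; rewrite psi0 /vertex eqxx =>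
      /(_ _ ltr01)/nbhs_ballP[e /= e0 eb].
  exists (Num.min e 1); first by rewrite lt_min e0 ltr01 ge_min lexx orbT.
  move=> q; rewrite lt_min => /andP[qe _]; apply: eb; rewrite -ball_normE /=.
  by have -> : (0, 0) - q = - q by [case: q {qe} => ? ?; congr pair;
      rewrite /= sub0r]; rewrite normrN.
have [e00 e1] := andP e0.
have sq q : `|q| < e -> square R q.
  by move=> qe; apply/square_norm; apply: le_trans (ltW qe) e1.
have sq0 : square R (0, 0) by apply: sq; rewrite plane_norm_lt /= normr0 e00.
have nz q : 0 < `|q| -> `|q| < e -> s (psi q) != 0.
  move=> q0 qe; apply/eqP => sq_0; have [f [_ _ _ alt]] := sP _ (psiK q) (eP q qe).
  have yv : psi q v = 1 by case: alt => -[_]; rewrite sq_0; lra.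
  have : psi q = psi (0, 0) by rewrite psi0; exact: realization_vertex.
  move=> /(congr1 phi); rewrite !phipsi //; last exact: sq.
  by move=> q00; move: q0; rewrite q00 plane_normE /= normr0 maxxx ltxx.
have curve (f : {set V}) w : f \in F -> v \in f -> w \in f -> w != v ->
    exists y : points, [/\ K y, N y, `|phi y| < e & 0 < y v < 1 /\ y w != 0].
  move=> fF vf wf wv.
  pose gam (t : R) : points := fun u => (1 - t) * vertex v u + t * vertex w u + 0 *
      vertex v u.
  have gam_cont : continuous gam.
    apply: segment_continuous => t; [|exact: cvg_id|exact: cvg_cst].
    by apply: cvgB; [exact: cvg_cst|exact: cvg_id].
  have gam0 : gam 0 = vertex v by apply/funext => u;
      rewrite /gam subr0 mul1r !mul0r !addr0.
  have [|t /andP[t0 t1] [Nt smallt]] := near_curve gam (N `&` [set y : points | K y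
      -> `|phi y| < e]) gam_cont.
    by rewrite gam0; apply: filterI => //; exact: phi_small.
  have Kt : K (gam t) by apply: (vertex_combination f) => //; lra.
  exists (gam t); split=> //; first exact: smallt.
  rewrite /gam /vertex eqxx (negbTE wv) [v == w]eq_sym (negbTE wv) eqxx.
  by rewrite !mulr0 !mulr1 !addr0 add0r gt_eqF //; split=> //; lra.
have other (f : {set V}) : f \in F -> exists2 w, w \in f & w != v.
  move=> fF; have : (0 < #|f :\ v|)%N.
    by have := cardsD1 v f; rewrite triangle3 //; case: (v \in f); case: #|_|.
  by rewrite card_gt0 => /set0Pn[w]; rewrite !inE => /andP[]; exists w.
have nonzero (y : points) : N y -> K y -> s y != 0 -> 0 < `|phi y|.
  move=> Ny Ky sy; rewrite normr_gt0; apply: contraNneq sy => phi0.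
  rewrite -(psiphi y Ny Ky) phi0 psi0.
  have [f [_ _ _ alt]] := sP _ (vertex_in_realization f0 v f0F vf0) ltac:(by rewrite
      /vertex eqxx).
  by case: alt => -[_ ->]; rewrite /vertex eqxx subrr.
have [w wf0 wv] := other f0 f0F; have [y [Ky Ny ye [/andP[yv0 yv1] yw]]] :=
    curve f0 w f0F vf0 wf0 wv.
have [u ug0 uv] := other g0 g0F; have [z [Kz Nz ze [/andP[zv0 zv1] zu]]] :=
    curve g0 u g0F vg0 ug0 uv.
have sy : 0 < s y.
  have [f [fF yf vf [[_ ->]|[fA _]]]] := sP y Ky yv0; first by lra.
  by have := share f0 f w f0A fA vf0 vf wf0 (yf w yw) => wv'; rewrite wv' eqxx in wv.
have sz : s z < 0.
  have [f [fF zf vf [[fA _]|[_ ->]]]] := sP z Kz zv0; last by lra.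
  by have := share f g0 u fA g0A vf vg0 (zf u zu) ug0 => uv'; rewrite uv' eqxx in uv.
apply: (punctured_sign (fun q => s (psi q)) e (phi z) (phi y) s_cont nz).
- by rewrite ze andbT nonzero // lt_eqF.
- by rewrite ye andbT nonzero // gt_eqF.
- by rewrite psiphi.
- by rewrite psiphi.
Qed.

End LocalStructure.

Section Edges.
Context (R : realType) (V : finType) (F : {set {set V}}).
Notation points := (prod_topology (fun _ : V => R)).
Local Notation K := (@realization R V F).
Local Notation vertex := (vertex R V).
Hypothesis triangle3 : forall f, f \in F -> #|f| = 3%N.
Hypothesis charts : forall x : points, K x -> chart_at R V K x.

Lemma third_vertex (f : {set V}) (a b : V) : #|f| = 3%N -> a \in f -> b \in f ->
    a != b ->
  exists c, [/\ c != a, c != b, c \in f & f = [set a; b; c]%SET].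
Proof.
move=> c3 af bf ab; have [w [u [aw au wu fE]]] := triangle_vertices V f a c3 af.
have wf : w \in f by rewrite fE !inE eqxx orbT.
have uf : u \in f by rewrite fE !inE eqxx orbT.
move: bf; rewrite {1}fE !inE eq_sym (negbTE ab) /= => /orP[/eqP bw|/eqP bu].
  by exists u; rewrite bw uf eq_sym au eq_sym wu.
exists w; rewrite bu wf eq_sym aw wu; split=> //.
by rewrite fE -!finset.setUA [([set w] :|: _)%SET]finset.setUC.
Qed.

Lemma plane_sub0 (q : R * R) : (0, 0) - q = - q.
Proof. by case: q => ? ?; congr pair; rewrite /= sub0r. Qed.

Lemma square_scale (r : R) (q : R * R) : 0 <= r -> square R q -> `|r *: q| <= r.
Proof. by move=> r0 /square_norm q1; rewrite normrZ ger0_norm // ler_piMr. Qed.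

(** Near the midpoint of a boundary edge, the realization would be a half-plane:
    a chart would embed a square in the plane, the image of whose centre lies on
    the boundary of a half-plane containing the whole image. *)
Lemma edge_has_two_triangles (f : {set V}) (a b : V) :
  f \in F -> a \in f -> b \in f -> a != b ->
  exists g, [/\ g \in F, g != f, a \in g & b \in g].
Proof.
move=> fF af bf ab; apply: contrapT => no.
have only g : g \in F -> a \in g -> b \in g -> g = f.
  by move=> gF ag bg; apply/eqP; apply: contraT => gf; exfalso; apply: no; exists g.
have [c [ca cb cf fE]] := third_vertex f a b (triangle3 f fF) af bf ab.
pose x0 : points := fun w => 2^-1 * vertex a w + 2^-1 * vertex b w + 0 * vertex c w.
have Kx0 : K x0 by apply: (vertex_combination R V F f) => //; lra.
have ba : (b == a) = false by rewrite eq_sym (negbTE ab).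
have x0a : x0 a = 2^-1.
  by rewrite /x0 /vertex eqxx (negbTE ab) eq_sym (negbTE ca) !mulr0 mulr1 !addr0.
have x0b : x0 b = 2^-1.
  by rewrite /x0 /vertex eqxx ba eq_sym (negbTE cb) !mulr0 mulr1 add0r addr0.
have x0c : x0 c = 0.
  by rewrite /x0 /vertex (negbTE ca) (negbTE cb) !mulr0 mul0r !addr0.
have [phi [psi [N [[nN psi_cont psi0 psiK] [phipsi _ _ _]]]]] := charts _ Kx0.
have psic v : continuous (fun q => psi q v) by exact: continuous_coordinate.
have half0 : 0 < 2^-1 :> R by rewrite invr_gt0.
have pos v : x0 v = 2^-1 -> exists2 e : R, 0 < e & forall q, `|q| < e -> 0 < psi q v.
  move=> xv; have := cvgr_gt _ (psic v (0, 0)) 0;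
      rewrite psi0 xv => /(_ _ half0)/nbhs_ballP[e /= e0 eb].
  by exists e => // q qe; apply: eb; rewrite -ball_normE /= plane_sub0 normrN.
have [e1 e10 e1P] := pos a x0a; have [e2 e20 e2P] := pos b x0b.
pose r : R := Num.min 1 (Num.min e1 e2) / 2.
have m0 : 0 < Num.min 1 (Num.min e1 e2) by rewrite !lt_min ltr01 e10.
have r0 : 0 < r by rewrite divr_gt0.
have r1 : r < 1 by have : Num.min 1 (Num.min e1 e2) <= 1;
    [rewrite ge_min lexx|rewrite /r; lra].
have re1 : r < e1.
  have : Num.min 1 (Num.min e1 e2) <= e1 by rewrite !ge_min lexx orbT.
  by rewrite /r; lra.
have re2 : r < e2.
  have : Num.min 1 (Num.min e1 e2) <= e2 by rewrite !ge_min lexx !orbT.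
  by rewrite /r; lra.
pose P (y : points) : R * R := (y a - y b, y c).
have PE (y : points) : K y -> 0 < y a -> 0 < y b ->
    (forall w, w != a -> w != b -> w != c -> y w = 0) /\ y a + y b + y c = 1.
  move=> Ky ya yb; have [g gF yg] := realization_support R V F y Ky.
  have gf : g = f by apply: only => //; apply: yg; rewrite gt_eqF.
  have out w : w \notin f -> y w = 0.
    by apply: contraNeq => /yg; rewrite gf.
  split=> [w wa wb wc|]; first by apply: out; rewrite fE !inE !negb_or wa wb.
  rewrite -(sum_support R V F y f Ky out) fE big_triangle //=.
  - by rewrite addrA.
  - by rewrite eq_sym.
  - by rewrite eq_sym.
have P_inj (y z : points) : K y -> K z -> 0 < y a -> 0 < y b -> 0 < z a -> 0 < z b ->
    P y = P z -> y = z.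
  move=> Ky Kz ya yb za zb [h1 h2].
  have [y0 ys] := PE y Ky ya yb; have [z0 zs] := PE z Kz za zb.
  have hb : y b = z b by lra.
  have ha : y a = z a by lra.
  apply/funext => w; have [->//|wa] := eqVneq w a; have [->//|wb] := eqVneq w b.
  have [->//|wc] := eqVneq w c; by rewrite y0 // z0.
pose h (q : R * R) : R * R := P (psi (r *: q)).
have h_cont : continuous h.
  have scale_cont : continuous (fun q : R * R => r *: q) by move=> q;
      exact: scaler_continuous.
  have hc (v : V) : continuous (fun q : R * R => psi (r *: q) v).
    move=> q; apply: (@continuous_comp _ _ _ (fun q : R * R => r *: q) (fun q =>
        psi q v)).
      exact: scale_cont.
    exact: psic.
  apply: continuous_pair_plane => q /=; last exact: hc.
  by apply: cvgB; exact: hc.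
have h_inj : {in square R &, injective h}.
  move=> q q'; rewrite !inE => qs q's.
  have := square_scale r q (ltW r0) qs; have :=
      square_scale r q' (ltW r0) q's => q'r qr.
  have sq p : `|p : R * R| <= r -> square R p.
    by move=> pr; apply/square_norm; apply: le_trans pr (ltW r1).
  move=> /P_inj hqq.
  have : psi (r *: q) = psi (r *: q').
    apply: hqq => //.
    - by apply: e1P; exact: le_lt_trans qr re1.
    - by apply: e2P; exact: le_lt_trans qr re2.
    - by apply: e1P; exact: le_lt_trans q'r re1.
    - by apply: e2P; exact: le_lt_trans q'r re2.
  move=> /(congr1 phi); rewrite !phipsi; [|exact: sq|exact: sq].
  by move=> /(congr1 ( *:%R r^-1)); rewrite !scalerA mulVf ?gt_eqF // !scale1r.
have [e e0 eP] := invariance_of_domain R h h_cont h_inj.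
have h0 : h (0, 0) = (0, 0).
  have -> : h (0, 0) = P (psi (0, 0)) by rewrite /h; congr (P (psi _)); congr pair;
      exact: mulr0.
  by rewrite psi0 /P x0a x0b x0c subrr.
have [|q _ hq] := eP (0, - (e / 2)).
  by rewrite h0 plane_norm_lt /= subr0 normr0 e0 subr0 normrN gtr0_norm ?divr_gt0 //;
      lra.
have := congr1 snd hq => /=; have [y0 _ _] := psiK (r *: q); have := y0 c; lra.
Qed.

(** The disc made of the triangles [abc] and [abd], parametrized around the midpoint
    of [ab]: [q.1] moves along the edge, and [q.2] away from it, towards [c] or
    [d] according to its sign. *)
Definition book (a b c d : V) (q : R * R) : points := fun w =>
  (2^-1 + q.1 / 8 - `|q.2| / 8) * vertex a w + (2^-1 - q.1 / 8 - `|q.2| / 8) * vertex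
      b w
  + Num.max q.2 0 / 4 * vertex c w + Num.max (- q.2) 0 / 4 * vertex d w.

Lemma book_continuous (a b c d : V) : continuous (book a b c d).
Proof.
apply: continuous_into_prod => w.
have c1 : continuous (fun q : R * R => q.1) by move=> q; exact: cvg_fst.
have c2 : continuous (fun q : R * R => q.2) by move=> q; exact: cvg_snd.
have c2n : continuous (fun q : R * R => `|q.2|) by move=> q; apply: cvg_norm; exact: c2.
have cp : continuous (fun q : R * R => Num.max q.2 0).
  by move=> q; apply: (@continuous_max R (R * R)%type snd (fun=> 0));
      [exact: c2|exact: (@cst_continuous (R * R)%type R 0 q)].
have cm : continuous (fun q : R * R => Num.max (- q.2) 0).
  by move=> q; apply: (@continuous_max R (R * R)%type (fun q => - q.2) (fun=> 0));
      [apply: cvgN; exact: c2|exact: (@cst_continuous (R * R)%type R 0 q)].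
move=> q.
apply: cvgD; [apply: cvgD; [apply: cvgD|]|]; apply: cvgM; try exact: cvg_cst.
- apply: cvgB; [apply: cvgD; [exact: cvg_cst|]|]; apply: cvgM; try exact: cvg_cst;
    [exact: c1|exact: c2n].
- apply: cvgB; [apply: cvgB; [exact: cvg_cst|]|]; apply: cvgM; try exact: cvg_cst;
    [exact: c1|exact: c2n].
- by apply: cvgM; [exact: cp|exact: cvg_cst].
- by apply: cvgM; [exact: cm|exact: cvg_cst].
Qed.

Lemma book_realization (a b c d : V) (f g : {set V}) (q : R * R) :
  f \in F -> g \in F -> a \in f -> b \in f -> c \in f -> a \in g -> b \in g ->
      d \in g ->
  square R q -> K (book a b c d q).
Proof.
move=> fF gF af bf cf ag bg dg /squareP[/andP[q1 q1'] /andP[q2 q2']].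
have [q20|q20] := lerP 0 q.2.
  have -> : book a b c d q = (fun w => (2^-1 + q.1 / 8 - q.2 / 8) * vertex a w +
      (2^-1 - q.1 / 8 - q.2 / 8) * vertex b w + q.2 / 4 * vertex c w).
    apply/funext => w; rewrite /book ger0_norm // max_l // max_r ?oppr_le0 //.
    by rewrite mul0r mul0r addr0.
  by apply: (vertex_combination R V F f) => //; lra.
have -> : book a b c d q = (fun w => (2^-1 + q.1 / 8 + q.2 / 8) * vertex a w +
    (2^-1 - q.1 / 8 + q.2 / 8) * vertex b w + - q.2 / 4 * vertex d w).
  apply/funext => w; rewrite /book ltr0_norm // max_r ?(ltW q20) // max_l;
      last by rewrite oppr_ge0 ltW.
  by rewrite mul0r mul0r addr0 mulNr opprK.
by apply: (vertex_combination R V F g) => //; lra.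
Qed.

(** Two of the triangles form a disc around the midpoint of the edge, whose
    image in a chart is a neighbourhood by invariance of domain; but points of
    the third triangle are arbitrarily close to the midpoint. *)
Lemma edge_has_no_third_triangle (a b : V) (f1 f2 f3 : {set V}) :
  f1 \in F -> f2 \in F -> f3 \in F -> a != b ->
  a \in f1 -> b \in f1 -> a \in f2 -> b \in f2 -> a \in f3 -> b \in f3 ->
  f1 != f2 -> f1 != f3 -> f2 != f3 -> False.
Proof.
move=> fF1 fF2 fF3 ab af1 bf1 af2 bf2 af3 bf3 f12 f13 f23.
have [c1 [c1a c1b c1f fE1]] := third_vertex f1 a b (triangle3 _ fF1) af1 bf1 ab.
have [c2 [c2a c2b c2f fE2]] := third_vertex f2 a b (triangle3 _ fF2) af2 bf2 ab.
have [c3 [c3a c3b c3f fE3]] := third_vertex f3 a b (triangle3 _ fF3) af3 bf3 ab.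
have c12 : c1 != c2 by apply: contraNneq f12 => c12; rewrite fE1 fE2 c12.
have c13 : c1 != c3 by apply: contraNneq f13 => c13; rewrite fE1 fE3 c13.
have c23 : c2 != c3 by apply: contraNneq f23 => c23; rewrite fE2 fE3 c23.
have ne x y : (x : V) != y -> ((x == y) = false) * ((y == x) = false).
  by move=> xy; rewrite [y == x]eq_sym !(negbTE xy).
pose G := book a b c1 c2.
have GK q : square R q -> K (G q) by exact: book_realization fF1 fF2 af1 bf1 c1f af2
    bf2 c2f.
have sq0 : square R (0, 0) by apply/square_norm; rewrite plane_norm_le /= normr0 ler01.
have Ga q : G q a = 2^-1 + q.1 / 8 - `|q.2| / 8.
  by rewrite /G /book /vertex eqxx !(ne _ _ ab, ne _ _ c1a,
      ne _ _ c2a) !mulr0 mulr1 !addr0.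
have Gb q : G q b = 2^-1 - q.1 / 8 - `|q.2| / 8.
  by rewrite /G /book /vertex eqxx !(ne _ _ ab, ne _ _ c1b,
      ne _ _ c2b) !mulr0 mulr1 !addr0 add0r.
have Gc1 q : G q c1 = Num.max q.2 0 / 4.
  by rewrite /G /book /vertex eqxx !(ne _ _ c12, ne _ _ c1a,
      ne _ _ c1b) !mulr0 mulr1 !addr0 !add0r.
have Gc2 q : G q c2 = Num.max (- q.2) 0 / 4.
  by rewrite /G /book /vertex eqxx !(ne _ _ c12, ne _ _ c2a,
      ne _ _ c2b) !mulr0 mulr1 !addr0 !add0r.
have Gc3 q : G q c3 = 0.
  by rewrite /G /book /vertex !(ne _ _ c13, ne _ _ c23, ne _ _ c3a,
      ne _ _ c3b) !mulr0 !addr0.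
have G_inj q q' : G q = G q' -> q = q'.
  move=> Gq; have h v : G q v = G q' v by rewrite Gq.
  have := h a; have := h b; have := h c1; have := h c2; rewrite !Ga !Gb !Gc1 !Gc2.
  have pm (t : R) : t = Num.max t 0 - Num.max (- t) 0.
    have [t0|] := boolP (0 <= t); first by rewrite max_l // max_r ?oppr_le0 ?subr0.
    by rewrite -ltNge => /ltW t0; rewrite max_r // max_l ?oppr_ge0 // sub0r opprK.
  move=> h2 h1 hb ha; rewrite [q]surjective_pairing [q']surjective_pairing.
  congr pair; first by lra.
  by rewrite [q.2]pm [q'.2]pm; lra.
have [phi [psi [N [[nN psi_cont psi0 psiK] [phipsi psiphi phi_small phi_cont]]]]] :=
    charts _ (GK _ sq0).
have nGN : nbhs (0, 0) (G @^-1` N) by apply: (book_continuous a b c1 c2 (0, 0)).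
have [r /andP[r0 r1] rN] : exists2 r : R, 0 < r <= 1 & forall q, `|q| <= r -> N (G q).
  have [e /= e0 eN] := (nbhs_ballP _ _).1 nGN.
  have m0 : 0 < Num.min e 1 by rewrite lt_min e0 ltr01.
  have me : Num.min e 1 <= e by rewrite ge_min lexx.
  have m1 : Num.min e 1 <= 1 by rewrite ge_min lexx orbT.
  exists (Num.min e 1 / 2); first by apply/andP; split; lra.
  by move=> q qr; apply: eN; rewrite -ball_normE /= plane_sub0 normrN; lra.
pose g (q : R * R) : points := G (r *: clamp R q).
have gr (q : R * R) : `|r *: clamp R q| <= r by apply: square_scale (ltW r0)
    (clamp_square R q).
have gNK q : N (g q) /\ K (g q).
  by split; [apply: rN|apply: GK; apply/square_norm; apply: le_trans (gr q) r1].
have g_cont : continuous g.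
  move=> q; apply: (@continuous_comp _ _ _ (fun q : R * R => r *: clamp R q) G);
      last exact: book_continuous.
  apply: (@continuous_comp _ _ _ (clamp R) (fun q : R * R => r *: q));
      first exact: clamp_continuous.
  exact: scaler_continuous.
have h_cont := phi_cont g g_cont gNK.
have h_inj : {in square R &, injective (fun q => phi (g q))}.
  move=> q q'; rewrite !inE => qs q's /(congr1 psi).
  have [[? ?] [? ?]] := (gNK q, gNK q'); rewrite !psiphi // => /G_inj.
  move=> /(congr1 ( *:%R r^-1)); rewrite !scalerA mulVf ?gt_eqF // !scale1r.
  by rewrite !clamp_id.
have [e e0 eP] := invariance_of_domain R _ h_cont h_inj.
have h0 : phi (g (0, 0)) = (0, 0).
  rewrite /g clamp_id //; have -> : r *: ((0, 0) : R * R) = (0, 0) by congr pair;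
      exact: mulr0.
  by rewrite -psi0 phipsi.
pose gam (t : R) : points := fun w => (2^-1 - t / 2) * vertex a w + (2^-1 - t / 2) *
    vertex b w + t * vertex c3 w.
have gam_cont : continuous gam.
  apply: segment_continuous => t; last exact: cvg_id.
    apply: cvgB; first exact: cvg_cst.
    by apply: cvgM; [exact: cvg_id|exact: cvg_cst].
  apply: cvgB; first exact: cvg_cst.
  by apply: cvgM; [exact: cvg_id|exact: cvg_cst].
have gam0 : gam 0 = G (0, 0).
  apply/funext => w; rewrite /gam /G /book /= normr0 oppr0 maxxx.
  by rewrite !mul0r !subr0 !addr0 ?mul0r ?addr0.
have [|t /andP[t0 t1] [Nt smallt]] := near_curve R V gam (N `&` [set y : points | K y
    -> `|phi y| < e]) gam_cont.
  by rewrite gam0; apply: filterI => //; exact: phi_small.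
have Kt : K (gam t) by apply: (vertex_combination R V F f3) => //; lra.
have [|q qs hq] := eP (phi (gam t)).
  rewrite h0; have -> : phi (gam t) - (0, 0) = phi (gam t).
    by case: (phi _) => ? ?; congr pair; exact: subr0.
  exact: smallt.
have [? ?] := gNK q; move: hq => /(congr1 psi);
    rewrite !psiphi // => /(congr1 (fun y : points => y c3)).
rewrite /g Gc3 /gam /vertex eqxx !(ne _ _ c3a, ne _ _ c3b) !mulr0 !add0r mulr1; lra.
Qed.

Lemma edge_in_two_triangles (e : {set V}) : e \in edges F ->
  #|[set f in F | e \subset f]%SET| = 2%N.
Proof.
move=> /edgesP[/eqP/cards2P[a [b [ab ->]]] [f fF]].
rewrite finset.subUset !finset.sub1set => /andP[af bf].
have [g [gF gf ag bg]] := edge_has_two_triangles f a b fF af bf ab.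
have -> : [set h in F | [set a; b] \subset h]%SET = [set f; g]%SET.
  apply/setP => h; rewrite !inE finset.subUset !finset.sub1set.
  apply/idP/idP => [/and3P[hF ah bh]|/orP[]/eqP->];
      [|by rewrite fF af|by rewrite gF ag].
  rewrite orbC; apply: contraT; rewrite negb_or => /andP[hg hf]; exfalso.
  by apply: (edge_has_no_third_triangle a b f g h) => //; rewrite eq_sym.
by rewrite cards2 eq_sym gf.
Qed.

End Edges.

(** * Constant curvature *)

Section ConstantCurvature.
Context (R : realType) (V : finType) (F : {set {set V}}).
Hypothesis triangle3 : forall f, f \in F -> #|f| = 3%N.
Hypothesis vertices_connected : forall I : {set V},
  I != finset.set0 -> I \proper [set: V]%SET ->
  exists f x y, [/\ f \in F, x \in f, y \in f, x \in I & y \notin I].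

Lemma star_mul (I : {set V}) : I != finset.set0 ->
  (#|F|%:R / #|V|%:R < #|triangles_meeting F I|%:R / #|I|%:R :> R) =
  (#|F|%:R * #|I|%:R < #|triangles_meeting F I|%:R * #|V|%:R :> R).
Proof.
move=> I0; have I_gt0 : 0 < #|I|%:R :> R by rewrite ltr0n card_gt0.
have V_gt0 : 0 < #|V|%:R :> R.
  by apply: lt_le_trans I_gt0 _; rewrite ler_nat max_card.
by rewrite ltr_pdivrMr // mulrAC ltr_pdivlMr.
Qed.

Lemma star_of_constant_curvature (d : {set V} -> R) :
  pl_metric F d -> constant_curvature F d -> star_condition R F.
Proof.
move=> pl const I I0 pI; rewrite star_mul //.
have a_gt0 f v : f \in F -> v \in f -> 0 < inner_angle d f v.
  by move=> fF vf; have [] := triangle_inner_angles V R F d f v pl fF (triangle3 f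
      fF) vf.
have a_sum f : f \in F -> \sum_(v in f) inner_angle d f v = pi.
  move=> fF; have /set0Pn[v vf] : f != finset.set0 by rewrite -card_gt0 triangle3.
  by have [] := triangle_inner_angles V R F d f v pl fF (triangle3 f fF) vf.
have /set0Pn[v0 v0I] := I0.
pose c : R := \sum_(f in F | v0 \in f) inner_angle d f v0.
have cE v : \sum_(f in F | v \in f) inner_angle d f v = c.
  by have := const v v0; rewrite /scalar_curvature -/c; lra.
have total := angle_total R V F (inner_angle d) a_sum.
have part := angle_sum_lt R V F (inner_angle d) a_gt0 a_sum vertices_connected I I0 pI.
move: total part; under eq_bigr do rewrite cE; rewrite sumr_const => total.
under eq_bigr do rewrite cE; rewrite sumr_const => part.
rewrite -(ltr_pM2l (pi_gt0 R)) mulrA -total mulrA.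
have -> : c *+ #|V| * #|I|%:R = c *+ #|I| * #|V|%:R.
  by rewrite -[c *+ #|V|]mulr_natr -[c *+ #|I|]mulr_natr mulrAC.
rewrite ltr_pM2r //; rewrite ltr0n; apply/card_gt0P; by exists v0.
Qed.

Lemma constant_curvature_of_star : star_condition R F ->
  exists d : {set V} -> R, pl_metric F d /\ constant_curvature F d.
Proof.
move=> star; pose theta (v : V) : R := pi * #|F|%:R / #|V|%:R.
have V0 (v : V) : 0 < #|V|%:R :> R by rewrite ltr0n; apply/card_gt0P; exists v.
have F0 : #|V| = 0%N -> #|F| = 0%N.
  move=> /card0_eq V0'; apply: eq_card0 => f; apply/negP => fF.
  have /set0Pn[v _] : f != finset.set0 by rewrite -card_gt0 triangle3.
  by have := V0' v; rewrite inE.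
have [||r r0 rE] := prescribed_cone_angles R V F triangle3 vertices_connected theta.
- rewrite sumr_const; have [V_eq0|V_gt0] := posnP #|V|.
    by rewrite V_eq0 F0 // mulr0n mulr0.
  by rewrite -[LHS]mulr_natr /theta divfK // pnatr_eq0 -lt0n.
- move=> I I0 pI; rewrite sumr_const; have := star I I0 pI; rewrite star_mul //.
  have /set0Pn[v _] := I0; rewrite -(ltr_pM2l (pi_gt0 R)).
  by rewrite -[X in _ -> X < _]mulr_natr /theta mulrAC ltr_pdivrMr ?V0 // !mulrA.
exists (tangency R V r); split; first exact: pl_metric_tangency.
have curv v : scalar_curvature F (tangency R V r) v = 2 * pi - theta v.
  rewrite /scalar_curvature -rE; congr (_ - _); apply: eq_bigr => f /andP[fF vf].
  by rewrite inner_angle_tangency ?triangle3.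
by move=> v w; rewrite !curv.
Qed.

End ConstantCurvature.

Theorem theorem1p1 (R : realType) (M : topologicalType) (V : finType)
    (F : {set {set V}})
    (hM : closed_connected_surface R M)
    (hT : triangulation R F M) :
  ((exists d : {set V} -> R, pl_metric F d /\ constant_curvature F d)
     <-> star_condition R F)
  /\ (0 <= euler_characteristic F -> star_condition R F).
Proof.
have [triangle3 covered homeo] := hT.
have [_ _ locM _ [_ conM]] := hM.
have charts := surface_chart R M V (@realization R V F) locM homeo.
have vertices_connected (I : {set V}) :=
  vertices_connected_of_surface R V F M I homeo conM covered.
split; first split.
- by move=> [d [pl const]]; apply: star_of_constant_curvature pl const.
- exact: constant_curvature_of_star.
- move=> chi I I0 pI; rewrite star_mul // -!natrM ltr_nat; apply: star_inequality => //.
  + exact: edge_in_two_triangles charts.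
  + exact: link_connected_of_charts charts.
  + by move: chi; rewrite /euler_characteristic; lia.
Qed.
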